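(* Let $\alpha>0$, and let $\{(u_k,z_k,\lambda_k)\}$ be generated by the stochastic ADMM algorithm described in the context with the following parameters: $\theta_{-1}=0$, $\theta_0=1$, and $\theta_{k+1}>0$ determined by $\theta_{k+1}^2=\theta_k^2+\theta_{k+1}$ for $k\ge0$; and $\rho_k=\rho\,\theta_k$, $\eta_k=\eta\,\theta_k$ for all $k$, where $\rho,\eta>0$ are constants with $\rho+\eta\le\alpha$ and $\eta(1-\mu)>\rho\mu$. Suppose $f$ is $\alpha$-strongly convex with $L$-Lipschitz gradient, and the stochastic gradient is unbiased with variance bounded by $\varrho^2$ (both as specified in the context). Then $$\lim_{k\to\infty}\mathbb E\big[\|u_k-u^{\ast}\|\big]=0\quad\text{and}\quad\lim_{k\to\infty}\mathbb E\big[\|z_k-z^{\ast}\|\big]=0.$$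
   Context: Setting. $U$ is a real Hilbert space with inner product $\langle\cdot,\cdot\rangle$ and norm $\|\cdot\|$; $U_{ad}\subset U$ is nonempty, closed and convex. $(\Omega,\mathcal F,\mathbb P)$ is a probability space, $\xi:\Omega\to\Xi\subset\mathbb R^n$ a random vector, and $f(u)=\mathbb E[F(u,\xi)]$ is well defined and finite for every $u\in U$, where for each $\xi\in\Xi$ the functional $F(\cdot,\xi)$ is convex and Fréchet differentiable; $f$ is then convex and Fréchet differentiable. $\nabla F(u,\xi)$ denotes the gradient in $u$. $g:U\to(-\infty,+\infty]$ is proper, lower semicontinuous and convex. Assumption on $f$. For all $u,v\in U$, $f(u)+\langle\nabla f(u),v-u\rangle+\frac{\alpha}{2}\|v-u\|^2\le f(v)$ and $\|\nabla f(u)-\nabla f(v)\|\le L\|u-v\|$. Assumption on the stochastic gradient. For all $u\in U$, $\mathbb E[\nabla F(u,\xi)]=\nabla f(u)$ and $\mathbb E[\|\nabla F(u,\xi)-\nabla f(u)\|^2]\le\varrho^2$. Problem. $\min_{u\in U_{ad},\,z\in U} f(u)+g(z)$ subject to $u=z$. $(u^{\ast},z^{\ast})$ is an optimal solution (so $u^{\ast}=z^{\ast}\in U_{ad}$) and $\lambda^{\ast}\in U$ an associated optimal Lagrange multiplier, i.e. $g(z)-g(z^{\ast})+\langle\nabla f(u^{\ast}),u-u^{\ast}\rangle-\langle\lambda^{\ast},u-z\rangle\ge 0$ for all $u\in U_{ad}$, $z\in U$; such a triple is assumed to exist. Algorithm. Choose (deterministic) $(u_0,z_0)=(v_0,s_0)\in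 U\times U$, initial multipliers $\psi_0=\lambda_0\in U$, and $\mu\in(0,1)$. For $k=0,1,2,\dots$: with parameters $\rho_k>0$, $\eta_k>0$, an integer $m_k>1$ and $\theta_k\ge 1$, generate realizations $\xi_{k,1},\dots,\xi_{k,m_k}$ of $\xi$ (all $\xi_{k,i}$, over all $k$ and $i$, are independent and distributed as $\xi$), set $G_k=\frac1{m_k}\sum_{i=1}^{m_k}\nabla F(v_k,\xi_{k,i})$, and compute $$ \begin{aligned} s_{k+1}&=\arg\min_{z\in U}\Big\{g(z)+\langle\lambda_k,z\rangle+\tfrac{\rho_k}{2}\|z-v_k\|^2\Big\},\\ v_{k+1}&=\arg\min_{u\in U_{ad}}\Big\{\langle G_k-\lambda_k,u\rangle+\tfrac{\rho_k}{2}\|u-s_{k+1}\|^2+\tfrac{\eta_k}{2}\|u-v_k\|^2\Big\},\\ \psi_{k+1}&=\psi_k-\mu\rho_k(v_{k+1}-s_{k+1}),\\ u_{k+1}&=(1-\theta_k^{-1})u_k+\theta_k^{-1}v_{k+1},\\ z_{k+1}&=(1-\theta_k^{-1})z_k+\theta_k^{-1}s_{k+1},\\ \lambda_{k+1}&=\psi_{k+1}-\mu\rho_k\theta_k(u_{k+1}-z_{k+1}). \end{aligned} $$ *)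

(* Defs.v *)
From HB Require Import structures.
From mathcomp Require Import all_boot all_order all_algebra.
From mathcomp Require Import all_classical all_reals all_analysis.

Set Implicit Arguments.
Unset Strict Implicit.
Unset Printing Implicit Defensive.

Import Order.TTheory GRing.Theory Num.Theory.
Import numFieldNormedType.Exports.

Local Open Scope classical_set_scope.
Local Open Scope ring_scope.

(* A real Hilbert space is a complete normed module [U] together with a form
   [ip : {dot U for idfun}] (bilinear, symmetric, positive definite) for which
   the following holds. *)
Definition norm_of_dot (R : realType) (U : normedModType R)
    (ip : {dot U for idfun}) : Prop :=
  forall x : U, `|x| ^+ 2 = ip x x.

Definition is_gradient (R : realType) (U : normedModType R)
    (ip : {dot U for idfun}) (f : U -> R) (u gr : U) : Prop :=
  is_diff u (f : U -> R^o) (ip gr).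

Definition eproper (R : realType) (U : Type) (g : U -> \bar R) : Prop :=
  (forall x, (-oo < g x)%E) /\ exists x, (g x < +oo)%E.

(* In [\bar R], [0 * +oo = 0]. *)
Definition econvex (R : realType) (U : lmodType R) (g : U -> \bar R) : Prop :=
  forall (t : R) (x y : U), 0 <= t <= 1 ->
    (g (t *: x + (1 - t) *: y)%R <= t%:E * g x + (1 - t)%:E * g y)%E.

Definition is_argmin (d : Order.disp_t) (V : porderType d) (U : Type)
    (D : set U) (phi : U -> V) (x : U) : Prop :=
  D x /\ forall y, D y -> (phi x <= phi y)%O.

Definition simple_fun (d : measure_display) (T : measurableType d) (U : Type)
    (h : T -> U) : Prop :=
  finite_set (range h) /\ forall y, measurable (h @^-1` [set y]).

Definition simple_expectation (d : measure_display) (T : measurableType d)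
    (R : realType) (P : probability T R) (U : normedModType R)
    (h : T -> U) : U :=
  \sum_(y \in range h) fine (P (h @^-1` [set y])) *: y.

(* Pointwise limit on [D] of simple functions defined on the whole space; this
   formulation is meaningful even if [D] is not measurable. *)
Definition strongly_measurable_on (d : measure_display) (T : measurableType d)
    (R : realType) (U : normedModType R) (D : set T) (X : T -> U) : Prop :=
  exists h : nat -> T -> U, (forall j, simple_fun (h j)) /\
    forall x, D x -> h j x @[j --> \oo] --> X x.

(* [X] is Bochner integrable and its Bochner integral is [a]. *)
Definition bochner_expectation (d : measure_display) (T : measurableType d)
    (R : realType) (P : probability T R) (U : normedModType R)
    (X : T -> U) (a : U) : Prop :=
  exists h : nat -> T -> U, [/\ forall j, simple_fun (h j),
    {ae P, forall w, h j w @[j --> \oo] --> X w},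
    'E_P[fun w => `|X w - h j w|%R]%E @[j --> \oo] --> 0%E &
    simple_expectation P (h j) @[j --> \oo] --> a].

Definition mutually_independent (d d' : measure_display)
    (T : measurableType d) (T' : measurableType d') (R : realType)
    (P : probability T R) (I : choiceType) (J : set I)
    (X : I -> T -> T') : Prop :=
  forall (r : seq I) (A : I -> set T'), uniq r ->
    (forall i, i \in r -> J i) -> (forall i, measurable (A i)) ->
    P (\bigcap_(i in [set` r]) (X i @^-1` A i)) =
    (\prod_(i <- r) P (X i @^-1` A i))%E.

(* Only the samples [xis k i] with [i < m k] are drawn at step [k]. *)
Definition iid_samples (d : measure_display) (T : measurableType d)
    (R : realType) (P : probability T R) (n : nat) (Xi : set (n.-tuple R))
    (xi : {RV P >-> n.-tuple R}) (m : nat -> nat)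
    (xis : nat -> nat -> {RV P >-> n.-tuple R}) : Prop :=
  [/\ forall k i w, (i < m k)%N -> Xi (xis k i w),
      forall k i (A : set (n.-tuple R)), (i < m k)%N -> measurable A ->
        distribution P (xis k i) A = distribution P xi A &
      mutually_independent P [set p : nat * nat | (p.2 < m p.1)%N]
        (fun p => xis p.1 p.2 : T -> n.-tuple R)].

Definition minibatch_gradient (T S : Type) (R : realType) (U : normedModType R)
    (gradF : U -> S -> U) (m : nat -> nat) (xis : nat -> nat -> T -> S)
    (v : nat -> T -> U) (k : nat) (w : T) : U :=
  (m k)%:R^-1 *: \sum_(i < m k) gradF (v k w) (xis k i w).

Record stochastic_admm (T S : Type) (R : realType) (U : normedModType R)
    (ip : {dot U for idfun}) (Uad : set U) (g : U -> \bar R)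
    (gradF : U -> S -> U) (m : nat -> nat) (xis : nat -> nat -> T -> S)
    (mu : R) (rho eta theta : nat -> R) (u0 z0 lam0 : U)
    (u z v s psi lam : nat -> T -> U) : Prop := StochasticADMM {
  admm_u0 : forall w, u 0%N w = u0;
  admm_z0 : forall w, z 0%N w = z0;
  admm_v0 : forall w, v 0%N w = u0;
  admm_s0 : forall w, s 0%N w = z0;
  admm_psi0 : forall w, psi 0%N w = lam0;
  admm_lam0 : forall w, lam 0%N w = lam0;
  admm_s : forall k w, is_argmin setT
    (fun x : U => (g x + (ip (lam k w) x
                          + rho k / 2 * `|x - v k w| ^+ 2)%:E)%E)
    (s k.+1 w);
  admm_v : forall k w, is_argmin Uad
    (fun x : U => ip (minibatch_gradient gradF m xis v k w - lam k w) x
                  + rho k / 2 * `|x - s k.+1 w| ^+ 2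
                  + eta k / 2 * `|x - v k w| ^+ 2)
    (v k.+1 w);
  admm_psi : forall k w,
    psi k.+1 w = psi k w - (mu * rho k) *: (v k.+1 w - s k.+1 w);
  admm_u : forall k w,
    u k.+1 w = (1 - (theta k)^-1) *: u k w + (theta k)^-1 *: v k.+1 w;
  admm_z : forall k w,
    z k.+1 w = (1 - (theta k)^-1) *: z k w + (theta k)^-1 *: s k.+1 w;
  admm_lam : forall k w,
    lam k.+1 w =
    psi k.+1 w - (mu * rho k * theta k) *: (u k.+1 w - z k.+1 w)
}.

Definition optimal_solution (R : realType) (U : Type) (Uad : set U)
    (f : U -> R) (g : U -> \bar R) (us zs : U) : Prop :=
  is_argmin [set p : U * U | Uad p.1 /\ p.1 = p.2]
    (fun p => ((f p.1)%:E + g p.2)%E) (us, zs).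

(* In [\bar R], [+oo - +oo = -oo]: since [g] is proper, the inequality forces
   [g zs] to be finite. *)
Definition lagrange_multiplier (R : realType) (U : normedModType R)
    (ip : {dot U for idfun}) (Uad : set U) (gradf : U -> U)
    (g : U -> \bar R) (us zs lams : U) : Prop :=
  forall u z : U, Uad u ->
    (0 <= g z - g zs + (ip (gradf us) (u - us) - ip lams (u - z))%:E)%E.

(* Main.v *)
Require Import Defs.
From HB Require Import structures.
From mathcomp Require Import all_boot all_order all_algebra.
From mathcomp Require Import all_classical all_reals all_analysis.
From mathcomp Require Import measurable_realfun.
From mathcomp Require Import ring lra.

(** Put [q_k = theta_{k-1}^2] (with [q_0 = 0]), so that [theta_k^2 - theta_k = q_k],
    and let [delta_k] be the error of the minibatch gradient at [v_k]. Along every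
    trajectory the function
      [W_k = alpha/2 q_k |u_k - u*|^2 + (rho + eta)/2 q_k |v_k - u*|^2
             + |lam_k - lam*|^2 / (4 mu rho)]
    decreases up to the term [- theta_k <delta_k, v_k - u*>], a multiple of
    [|delta_k|^2], and [(L theta_k - rho/8 theta_k^2) |v_{k+1} - v_k|^2]: the two
    minimization steps are monotone operators fixing [u*], the strong convexity of
    [f] pays for the growth of [q_k], and the multiplier terms telescope because
    [lam_k = lam_0 - 2 mu rho q_k (u_k - z_k)]. The coefficient of the last term is
    negative for all but finitely many [k]. Since [v_k] is a function of the samples
    drawn before step [k], the first term has mean zero and the second one is
    bounded in mean, so [E W_k] grows at most linearly, whereas [theta_k^2] grows
    quadratically. Dividing gives [E |u_k - u*|^2 -> 0], and the formula for
    [lam_k] gives [E |u_k - z_k| -> 0]. *)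

(** The one-step inequality is pure algebra; the obstacle is to take its mean. The iterates are
    arbitrary functions satisfying the recursion, [U] need not be separable and [Xi] need not be
    measurable, so measurability has to be derived. At fixed [k] each minimizer is a Lipschitz
    function of its data, hence [v k] and [lam k] are strongly measurable for the sigma-algebra of
    the samples drawn before step [k]. The sampled gradient then depends on two independent
    arguments, the past and the new sample. It is jointly measurable because it is continuous in the
    point, a consequence of convexity and differentiability of [F], and Fubini on the product of the
    two laws does the work of conditional expectations. Integrability of the cross term requires
    second moments, which the same induction propagates; they also make the finitely many steps with
    a positive increment coefficient cost only a constant. The iterates [u k] and [z k] are handled
    by domination: the expectation of a nonnegative function is bounded by that of an integrable
    majorant. *)

Set Implicit Arguments.
Unset Strict Implicit.
Unset Printing Implicit Defensive.

Import Order.TTheory GRing.Theory Num.Theory.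
Import numFieldNormedType.Exports.

Local Open Scope classical_set_scope.
Local Open Scope ring_scope.

(** * Convexity in Hilbert spaces *)

Section InnerProduct.
Variables (R : realType) (U : normedModType R) (ip : {dot U for idfun}).
Hypothesis hip : norm_of_dot ip.

Lemma ipC x y : ip x y = ip y x.
Proof. by rewrite hermC /= expr0 mul1r. Qed.

Lemma ipDl x y z : ip (x + y) z = ip x z + ip y z.
Proof. exact: linearDl. Qed.

Lemma ipDr x y z : ip z (x + y) = ip z x + ip z y.
Proof. by rewrite ipC ipDl !(ipC z). Qed.

Lemma ipZl a x y : ip (a *: x) y = a * ip x y.
Proof. exact: linearZl_LR. Qed.

Lemma ipZr a x y : ip x (a *: y) = a * ip x y.
Proof. by rewrite ipC ipZl ipC. Qed.

Lemma ipNl x y : ip (- x) y = - ip x y.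
Proof. by rewrite -scaleN1r ipZl mulN1r. Qed.

Lemma ipNr x y : ip y (- x) = - ip y x.
Proof. by rewrite ipC ipNl ipC. Qed.

Lemma ip0l x : ip 0 x = 0.
Proof. by rewrite -(scale0r x) ipZl mul0r. Qed.

Lemma ip0r x : ip x 0 = 0.
Proof. by rewrite ipC ip0l. Qed.

Lemma ip_suml I (r : seq I) (Q : pred I) (h : I -> U) y :
  ip (\sum_(i <- r | Q i) h i) y = \sum_(i <- r | Q i) ip (h i) y.
Proof.
elim/big_rec2: _ => [|i a b _ <-]; first by rewrite ip0l.
by rewrite ipDl.
Qed.

Definition ipE := (ipDl, ipDr, ipNl, ipNr, ipZl, ipZr).

Lemma normsqD x y : `|x + y| ^+ 2 = `|x| ^+ 2 + 2 * ip x y + `|y| ^+ 2.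
Proof. by rewrite !hip !ipE (ipC y x); ring. Qed.

Lemma normsqB x y : `|x - y| ^+ 2 = `|x| ^+ 2 - 2 * ip x y + `|y| ^+ 2.
Proof. by rewrite normsqD normrN ipNr; ring. Qed.

Lemma ip_young x y c : 0 < c ->
  ip x y <= c / 2 * `|x| ^+ 2 + (2 * c)^-1 * `|y| ^+ 2.
Proof.
move=> c0.
have := sqr_ge0 `|c *: x - y|.
rewrite normsqB normrZ ipZl gtr0_norm // exprMn => h.
rewrite -subr_ge0.
rewrite (_ : _ - _ = (2 * c)^-1 * (c ^+ 2 * `|x| ^+ 2 - 2 * (c * ip x y) + `|y| ^+ 2)).
  by rewrite mulr_ge0 // invr_ge0 mulr_ge0 // ltW.
by field; rewrite gt_eqF.
Qed.

Lemma CauchySchwarz x y : ip x y <= `|x| * `|y|.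
Proof.
have [->|x0] := eqVneq x 0; first by rewrite ip0l normr0 mul0r.
have [->|y0] := eqVneq y 0; first by rewrite ip0r normr0 mulr0.
have nx : 0 < `|x| by rewrite normr_gt0.
have ny : 0 < `|y| by rewrite normr_gt0.
have := @ip_young x y (`|y| / `|x|) (divr_gt0 ny nx).
rewrite (_ : _ + _ = `|x| * `|y|) //; field.
by rewrite !gt_eqF.
Qed.

Lemma CauchySchwarz_norm x y : `|ip x y| <= `|x| * `|y|.
Proof.
rewrite ler_norml CauchySchwarz andbT lerNl -ipNl.
by rewrite -(normrN x) CauchySchwarz.
Qed.

Lemma normsq_convex (t : R) (x y : U) : 0 <= t <= 1 ->
  `|(1 - t) *: x + t *: y| ^+ 2 <= (1 - t) * `|x| ^+ 2 + t * `|y| ^+ 2.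
Proof.
move=> /andP[t0 t1].
have : 0 <= t * (1 - t) * `|x - y| ^+ 2.
  by rewrite !mulr_ge0 ?subr_ge0 ?exprn_ge0.
by rewrite normsqB normsqD !normrZ !ipE !exprMn !real_normK ?num_real //; nra.
Qed.

End InnerProduct.

(** Replaces the limit [t -> 0] in first-order optimality conditions; [c] collects the second-order
    terms. *)
Lemma ler_of_small_slope (R : realType) (a b c : R) :
  (forall t, 0 < t -> t <= 1 -> a <= b + t * c) -> a <= b.
Proof.
move=> h; rewrite leNgt; apply/negP => ba.
have c0 : 0 < c.
  by have := h 1 ltr01 (lexx _); rewrite mul1r => ?; lra.
pose t := Num.min 1 ((a - b) / (2 * c)).
have t0 : 0 < t by rewrite lt_min ltr01 divr_gt0 ?subr_gt0 ?mulr_gt0.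
have t1 : t <= 1 by rewrite ge_min lexx.
have : t * c <= (a - b) / 2.
  rewrite -ler_pdivlMr //.
  rewrite (_ : _ / 2 / c = (a - b) / (2 * c)) ?ge_min ?lexx ?orbT //.
  by field; rewrite gt_eqF.
by have := h t t0 t1; lra.
Qed.

(** * First-order optimality conditions for the two minimization steps *)

Section VariationalInequalities.
Variables (R : realType) (U : normedModType R) (ip : {dot U for idfun}).
Hypothesis hip : norm_of_dot ip.

Lemma normsq_line (x y w : U) (t : R) :
  `|x + t *: y - w| ^+ 2 =
  `|x - w| ^+ 2 + t * (2 * ip (x - w) y + t * `|y| ^+ 2).
Proof.
rewrite (_ : x + t *: y - w = (x - w) + t *: y); last by rewrite addrAC.
rewrite (normsqD hip) normrZ exprMn real_normK ?num_real // ipZr; ring.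
Qed.

Lemma convex_setP (C : set U) : convex_set (C : set (convex_lmodType U)) ->
  forall x y (t : R), C x -> C y -> 0 < t -> t <= 1 -> C (x + t *: (y - x)).
Proof.
move=> Cc x y t Cx Cy t0 t1.
have i01 : Itv.spec (@Itv.num_sem R) (Itv.Real `[0%Z, 1%Z]) t.
  by rewrite /= /Itv.num_sem /= num_real in_itv /= ltW.
have := Cc y x (Itv.mk i01).
rewrite !inE => /(_ Cy Cx); rewrite /conv /= => H.
rewrite (_ : x + _ = t *: y + (1 - t) *: x) //.
by rewrite scalerBr scalerBl scale1r addrCA.
Qed.

(** Compares [x] with the points of the segment towards [y], which lies in [C] by convexity, and
    divides by the step length [t]. *)
Lemma argmin_quadratic_le (C : set U) (w p q : U) (r h : R) (x y : U) :
  convex_set (C : set (convex_lmodType U)) ->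
  is_argmin C (fun x => ip w x + r / 2 * `|x - p| ^+ 2
                        + h / 2 * `|x - q| ^+ 2) x ->
  C y -> ip (w + r *: (x - p) + h *: (x - q)) (x - y) <= 0.
Proof.
move=> Cc [Cx xmin] Cy.
apply: (@ler_of_small_slope _ _ _ ((r + h) / 2 * `|y - x| ^+ 2)) => t t0 t1.
have := xmin _ (convex_setP Cc Cx Cy t0 t1).
rewrite !normsq_line !ipE => H.
rewrite -(@ler_pM2l _ t) //.
by move: H; nra.
Qed.

(** The inequality says that [- (l + r *: (x - p))] is a subgradient of [g] at [x]. The segment
    argument works with convexity of [g] in place of linearity; [g x] is finite by comparison with a
    point where [g] is. *)
Lemma argmin_prox_le (g : U -> \bar R) (l p : U) (r : R) (x y : U) :
  eproper g -> econvex g ->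
  is_argmin setT
    (fun x => (g x + (ip l x + r / 2 * `|x - p| ^+ 2)%:E)%E) x ->
  g x \is a fin_num /\ (g x + (ip (l + r *: (x - p)) (x - y))%:E <= g y)%E.
Proof.
move=> [gNy [x0 gx0]] gc [_ xmin].
have gx : g x \is a fin_num.
  rewrite fin_numE gt_eqF ?gNy //=; apply/eqP => gx.
  have := xmin x0 I; rewrite gx addye // leye_eq => /eqP.
  by case: (g x0) gx0.
split=> //; have := gNy y; case gyE : (g y) => [gy| |] // _; last by rewrite leey.
move: gx gyE; case gxE : (g x) => [gx| |] // _ gyE.
rewrite -EFinD lee_fin.
apply: (@ler_of_small_slope _ _ _ (r / 2 * `|y - x| ^+ 2)) => t t0 t1.
have t01 : 0 <= t <= 1 by rewrite ltW.
have := xmin (x + t *: (y - x)) I.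
have := gc t y x t01.
rewrite gxE gyE (_ : t *: y + _ = x + t *: (y - x)); last first.
  by rewrite scalerBr scalerBl scale1r [RHS]addrCA.
case: (g (x + _)) (gNy (x + t *: (y - x))) => [gz| |] // _.
rewrite -!EFinM -!EFinD !lee_fin !normsq_line !ipE => H1 H2.
rewrite -(@ler_pM2l _ t) //.
by move: H1 H2; nra.
Qed.

End VariationalInequalities.

(** * Gradients of differentiable convex functions *)

Section Gradients.
Variables (R : realType) (U : normedModType R) (ip : {dot U for idfun}).
Hypothesis hip : norm_of_dot ip.

Lemma is_gradient_expansion (f : U -> R) (u gr : U) : is_gradient ip f u gr ->
  forall e, 0 < e -> exists2 r : R, 0 < r &
    forall h, `|h| < r -> `|f (u + h) - f u - ip gr h| <= e * `|h|.
Proof.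
move=> [df dfE] e e0.
have := diff_locallyxC df; set k := 'o _ => fE.
have /(littleoP [littleo of k])/nbhs_normP[r /= r0 H] := e0.
exists r => // h hr.
have := H h; rewrite /ball_ /= sub0r normrN => /(_ hr).
have -> // : k h = f (u + h) - f u - ip gr h.
have fEh : f (u + h) = (f u + ip gr h + (k h : R)) :> R by rewrite fE dfE.
by rewrite fEh [RHS]addrAC -addrA; lra.
Qed.

Definition gradient_le (f : U -> R) (gradf : U -> U) :=
  forall u v, f u + ip (gradf u) (v - u) <= f v.

Lemma convex_gradient_le (f : U -> R) (gradf : U -> U) :
  convex_function (setT : set (convex_lmodType U)) f ->
  (forall u, is_gradient ip f u (gradf u)) -> gradient_le f gradf.
Proof.
move=> fc fg u v.
rewrite leNgt; apply/negP => lt.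
have [uv|uv] := eqVneq v u.
  by move: lt; rewrite uv subrr ip0r addr0 ltxx.
have n0 : 0 < `|v - u| by rewrite normr_gt0 subr_eq0.
pose gap := f u + ip (gradf u) (v - u) - f v.
have gap0 : 0 < gap by rewrite subr_gt0.
(* With this tolerance the expansion error at [u + t *: (v - u)] is [t * gap / 2], whereas convexity
   forces an error of at least [t * gap]. *)
have e0 : 0 < gap / (2 * `|v - u|) by rewrite divr_gt0 // mulr_gt0.
have [r r0 H] := is_gradient_expansion (fg u) e0.
pose t := Num.min 1 (r / (2 * `|v - u|)).
have t0 : 0 < t by rewrite lt_min ltr01 divr_gt0 // mulr_gt0.
have t1 : t <= 1 by rewrite ge_min lexx.
have tr : `|t *: (v - u)| < r.
  rewrite normrZ gtr0_norm // -ltr_pdivlMr //.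
  rewrite gt_min; apply/orP; right.
  rewrite ltr_pM2l // ltf_pV2 ?posrE ?mulr_gt0 //.
  by rewrite ltr_pMl // ltr1n.
have := H _ tr; rewrite normrZ gtr0_norm // => /ler_normlP[+ _].
rewrite ipZr.
have i01 : Itv.spec (@Itv.num_sem R) (Itv.Real `[0%Z, 1%Z]) t.
  by rewrite /= /Itv.num_sem /= num_real in_itv /= ltW.
have := fc (Itv.mk i01) v u; rewrite !inE => /(_ I I); rewrite /conv /=.
rewrite (_ : t *: v + _ = u + t *: (v - u)); last first.
  by rewrite scalerBr scalerBl scale1r [RHS]addrCA.
rewrite /conv /=; set A := f (u + _).
rewrite (_ : gap / (2 * `|v - u|) * (t * `|v - u|) = t * gap / 2); last first.
  by field; rewrite gt_eqF.
move=> fA H2; have {fA} : A <= t * f v + (1 - t) * f u by exact: fA.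
move: H2 => H2 H1.
have : t * (gap / 2) <= 0.
  by rewrite /gap in H2 *; nra.
by rewrite pmulr_lle0 //; lra.
Qed.

(* Testing the subgradient inequality at [v] with the points [u + h], [|h| = r],
   bounds [r * |gradf v - gradf u|] by the error of the expansion at [u]. *)
Lemma gradient_continuous (f : U -> R) (gradf : U -> U) :
  gradient_le f gradf -> (forall u, is_gradient ip f u (gradf u)) ->
  continuous gradf.
Proof.
move=> fle fg u; apply/cvgrPdist_le => e e0.
have e20 : 0 < e / 2 by rewrite divr_gt0.
have [r r0 H] := is_gradient_expansion (fg u) e20.
near=> v.
rewrite distrC; set p := gradf v - gradf u.
have [->|p0] := eqVneq p 0; first by rewrite normr0 ltW.
have np : 0 < `|p| by rewrite normr_gt0.
pose h := (r / 2 / `|p|) *: p.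
have nh : `|h| = r / 2.
  by rewrite normrZ gtr0_norm ?divr_gt0 // divfK // gt_eqF.
have := H h; rewrite nh => /(_ _)/ler_normlP[|_ H1].
  by rewrite ltr_pdivrMr // ltr_pMr // ltr1n.
have H2 := fle v (u + h); have H3 := fle u v.
(* The term [ip p (v - u)] then takes at most half of [ip p h = r / 2 * |p|]; the other half is
   bounded by the expansion error [e * r / 4]. *)
have vu : `|v - u| <= r / 4.
  rewrite distrC; near: v.
  by apply: cvgr_dist_le; rewrite ?divr_gt0.
have php : ip p h = r / 2 * `|p|.
  rewrite ipZr -hip.
  by field; rewrite gt_eqF.
have := CauchySchwarz hip p (v - u).
have : `|p| * `|v - u| <= `|p| * (r / 4) by rewrite ler_pM2l.
move: H1 H2 H3 php; rewrite /p !ipE -!/p => H1 H2 H3 H4 H5 H6.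
rewrite -(@ler_pM2l _ r) //; nra.
Unshelve. all: by end_near. Qed.

End Gradients.

(** * The one-step inequality for the Lyapunov function *)

Section DescentStep.
Variables (R : realType) (U : normedModType R) (ip : {dot U for idfun}).
Hypothesis hip : norm_of_dot ip.
Variables (alpha L mu rho eta th : R).
Hypotheses (mu01 : 0 < mu < 1) (rho0 : 0 < rho) (eta0 : 0 < eta)
  (rho_eta_le : rho + eta <= alpha) (eta_mu : eta * (1 - mu) > rho * mu)
  (th1 : 1 <= th).

(** With [c = a + b] the left side is [- rho (1 - mu) |c|^2 + rho <c, a> - (rho + eta)/2 |a|^2].
    Young's inequality with weight [2 (1 - mu)] cancels [|c|^2], and [eta_mu] leaves at least
    [rho/4] of [|a|^2]. *)
Lemma quadratic_defect_le (a b : U) :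
  (mu * rho - rho / 2) * `|a + b| ^+ 2 - rho / 2 * `|b| ^+ 2
    - eta / 2 * `|a| ^+ 2 <= - (rho / 4) * `|a| ^+ 2.
Proof.
have /andP[mu0 mu1] := mu01.
have m1 : 0 < 1 - mu by rewrite subr_gt0.
pose c := a + b; have -> : b = c - a by rewrite /c addrC addKr.
rewrite -/c (_ : a + (c - a) = c); last by rewrite addrC subrK.
have Y := @ip_young _ _ ip hip c a (2 * (1 - mu)) (mulr_gt0 (ltr0Sn R 1) m1).
rewrite (normsqB hip).
have A0 := sqr_ge0 `|a|.
have H : (4 * (1 - mu))^-1 * rho <= rho / 2 + eta / 2 - rho / 4.
  rewrite mulrC ler_pdivrMr ?mulr_gt0 //.
  have := mulr_gt0 rho0 mu0; move: eta_mu; lra.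
have Y' : rho * ip c a <= rho * ((2 * (1 - mu) / 2) * `|c| ^+ 2 +
   (2 * (2 * (1 - mu)))^-1 * `|a| ^+ 2) by rewrite ler_pM2l.
have E : (2 * (2 * (1 - mu)))^-1 = (4 * (1 - mu))^-1.
  by congr (_^-1); ring.
rewrite E in Y'.
have := ler_wpM2r A0 H.
move: Y'; set k := (4 * (1 - mu))^-1.
by move=> Y' H'; lra.
Qed.

(** Here [e = v_k - us], [a = v_{k+1} - v_k], [b = v_k - s_{k+1}], [l = lam_k - lams],
    [p = u_k - us]; [dl] is the gradient error and [gd] the difference of exact gradients at [v_k]
    and [us]. All hypotheses are multiplied by [th] and added; the proximal terms produce the
    difference of [(rho + eta)/2 th^2 |v - us|^2] and the form of [quadratic_defect_le]. *)
Lemma lyapunov_step (e a b l dl gd p : U) :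
  ip (l + (rho * th) *: (- b)) (e - b) <= 0 ->
  ip (dl + gd - l + (rho * th) *: (a + b) + (eta * th) *: a) (e + a) <= 0 ->
  alpha / 2 * `|e| ^+ 2 + alpha / 2 * `|e + a| ^+ 2 - L * `|a| ^+ 2
    <= ip gd (e + a) ->
  alpha / 2 * (th ^+ 2 * `|(1 - th^-1) *: p + th^-1 *: (e + a)| ^+ 2)
    + (rho + eta) / 2 * (th ^+ 2 * `|e + a| ^+ 2)
    + (4 * (mu * rho))^-1 * `|l - (2 * (mu * rho * th)) *: (a + b)| ^+ 2
  <= alpha / 2 * ((th ^+ 2 - th) * `|p| ^+ 2)
    + (rho + eta) / 2 * ((th ^+ 2 - th) * `|e| ^+ 2)
    + (4 * (mu * rho))^-1 * `|l| ^+ 2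
    - th * ip dl e + 2 / rho * `|dl| ^+ 2
    + Num.max 0 (L * th - rho / 8 * th ^+ 2) * `|a| ^+ 2.
Proof.
move=> HS HV HF.
have /andP[mu0 mu1] := mu01.
have th0 : 0 < th by apply: lt_le_trans th1.
have mr0 : 0 < mu * rho by rewrite mulr_gt0.
have a0 : 0 <= alpha by apply: le_trans rho_eta_le; rewrite addr_ge0 // ltW.
(* The extra [th * |e + a|^2] is paid by the second strong convexity term of [HF]. *)
have Hp : th ^+ 2 * `|(1 - th^-1) *: p + th^-1 *: (e + a)| ^+ 2
    <= (th ^+ 2 - th) * `|p| ^+ 2 + th * `|e + a| ^+ 2.
  have t01 : 0 <= th^-1 <= 1 by rewrite invr_ge0 ltW //= invf_le1.
  have := normsq_convex hip p (e + a) t01.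
  rewrite -(@ler_pM2l _ (th ^+ 2)) ?exprn_gt0 //.
  move/le_trans; apply; rewrite le_eqVlt; apply/orP; left; apply/eqP.
  by field; rewrite gt_eqF.
(* The weight [1 / (4 mu rho)] makes the cross term exactly [th * ip l (a + b)], which cancels
   against the multiplier terms of [HS] and [HV]. *)
have Hl : (4 * (mu * rho))^-1 * `|l - (2 * (mu * rho * th)) *: (a + b)| ^+ 2
    = (4 * (mu * rho))^-1 * `|l| ^+ 2 - th * ip l (a + b)
      + mu * rho * th ^+ 2 * `|a + b| ^+ 2.
  rewrite (normsqB hip) normrZ ipZr exprMn real_normK ?num_real //.
  by field; rewrite !gt_eqF.
have HQ := quadratic_defect_le a b.
(* The Young weight spends one half of the gain [rho/4 th^2 |a|^2] of [quadratic_defect_le]; the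
   other half is left to compete with [L th |a|^2]. *)
have HY : - (th * ip dl a) <= 2 / rho * `|dl| ^+ 2 + rho / 8 * th ^+ 2 * `|a| ^+ 2.
  have := @ip_young _ _ ip hip (- dl) (th *: a) (4 / rho) (divr_gt0 (ltr0Sn R 3) rho0).
  rewrite ipNl ipZr normrN normrZ exprMn real_normK ?num_real //.
  rewrite (_ : 4 / rho / 2 = 2 / rho); last by field; rewrite gt_eqF.
  rewrite (_ : (2 * (4 / rho))^-1 = rho / 8); last by field; rewrite gt_eqF.
  by move=> H; lra.
have HM : (L * th - rho / 8 * th ^+ 2) * `|a| ^+ 2 <=
   Num.max 0 (L * th - rho / 8 * th ^+ 2) * `|a| ^+ 2.
  by rewrite ler_wpM2r ?sqr_ge0 // le_max lexx orbT.
(* Raising the coefficient of [|e|^2] from [th^2 - th] to [th^2] is paid by the first strong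
   convexity term of [HF]. *)
have HE : (rho + eta) * (th * `|e| ^+ 2) <= alpha * (th * `|e| ^+ 2).
  by rewrite ler_wpM2r // mulr_ge0 ?sqr_ge0 // ltW.
rewrite Hl.
have {}HF := ler_wpM2l (ltW th0) HF.
have {}HS : th * ip (l + (rho * th) *: (- b)) (e - b) <= 0.
  by rewrite pmulr_rle0.
have {}HV : th * ip (dl + gd - l + (rho * th) *: (a + b) + (eta * th) *: a) (e + a) <= 0.
  by rewrite pmulr_rle0.
have {}HQ := ler_wpM2l (sqr_ge0 th) HQ.
have {}Hp := ler_wpM2l (divr_ge0 a0 (ler0n R 2)) Hp.
move: HS HV HF HQ Hp HY HM HE.
set Q := `|(1 - th^-1) *: p + _|; set M := Num.max _ _; set k := (4 * (mu * rho))^-1.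
rewrite !(normsqD hip) !ipE -!hip (ipC _ a e) (ipC _ b e) (ipC _ b a).
move: (`|e| ^+ 2) (`|a| ^+ 2) (`|b| ^+ 2) (`|l| ^+ 2) (`|dl| ^+ 2) (`|p| ^+ 2).
move=> E A B l2 d2 p2 HS HV HF HQ Hp HY HM HE.
lra.
Qed.

End DescentStep.

(** * Strongly measurable functions *)

Section StronglyMeasurable.
Variable R : realType.

(* This is the strong measurability of Pettis: it is equivalent to being a
   pointwise limit of simple functions but is easier to transport. *)
Definition separably_valued (T : Type) (V : normedModType R) (X : T -> V) :=
  exists c : nat -> V, forall w (e : R), 0 < e -> exists i, `|X w - c i| < e.

Definition pettis (d : measure_display) (T : measurableType d)
    (V : normedModType R) (X : T -> V) :=
  separably_valued X /\ forall y, measurable_fun setT (fun w => `|X w - y|).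

Lemma separably_valuedI (T : Type) (V : normedModType R) (X : T -> V)
    (I : countType) (i0 : I) (c : I -> V) :
  (forall w (e : R), 0 < e -> exists i, `|X w - c i| < e) -> separably_valued X.
Proof.
move=> H; exists (fun k => c (odflt i0 (unpickle k))) => w e e0.
by have [i Hi] := H w e e0; exists (pickle i); rewrite pickleK.
Qed.

Variables (d : measure_display) (T : measurableType d).

Let invS_gt0 n : 0 < n.+1%:R^-1 :> R. Proof. by rewrite invr_gt0. Qed.

Lemma measurable_lt_set (f : T -> R) (a : R) :
  measurable_fun setT f -> measurable [set w | f w < a].
Proof.
move=> mf; rewrite -[X in measurable X]setTI -preimage_itvNyo.
by apply: mf => //; exact: measurable_itv.
Qed.

Lemma measurable_le_set (f : T -> R) (a : R) :
  measurable_fun setT f -> measurable [set w | f w <= a].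
Proof.
move=> mf; rewrite -[X in measurable X]setTI -preimage_itvNyc.
by apply: mf => //; exact: measurable_itv.
Qed.

Lemma measurable_fun_lt_sets (f : T -> R) :
  (forall a, measurable [set w | f w < a]) -> measurable_fun setT f.
Proof.
move=> H mT; apply: (measurability _ (RGenInftyO.measurableE R)) => //.
by move=> _ [_ [a ->] <-]; rewrite setTI preimage_itvNyo.
Qed.

(** Lindelöf argument: a set that is open for the pseudometric of [X] is the union of the balls that
    it contains among those with centre [c i] and radius [1/(n+1)], and these are countably many. *)
Lemma pettis_open (V : normedModType R) (X : T -> V) (O : set T) : pettis X ->
  (forall w, O w -> exists2 r : R, 0 < r & forall w', `|X w - X w'| < r -> O w') ->
  measurable O.
Proof.
move=> [[c cX] mX] oO.
pose B i (n : nat) := [set w | `|X w - c i| < n.+1%:R^-1].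
rewrite (_ : O = \bigcup_i \bigcup_(n in [set n | B i n `<=` O]) B i n).
  apply: bigcupT_measurable => i; apply: bigcup_measurable => n _.
  exact: measurable_lt_set.
apply/seteqP; split=> [w Ow|w [i _ [n /= BO]]]; last exact: BO.
have [r r0 rO] := oO w Ow.
have [n _ nr] := near_infty_natSinv_lt (PosNum (divr_gt0 r0 (ltr0Sn R 1))).
have {}nr := nr n (leqnn n); rewrite /= in nr.
have [i wi] := cX w n.+1%:R^-1 (invS_gt0 n).
exists i => //; exists n => //= w' Bw'.
apply: rO; have : `|X w - X w'| <= `|X w - c i| + `|X w' - c i|.
  by rewrite (distrC (X w') (c i)); exact: ler_distD.
move=> /le_lt_trans; apply; rewrite [ltRHS]splitr.
by rewrite ltrD //; [exact: lt_trans wi nr|exact: lt_trans Bw' nr].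
Qed.

(** Continuity of [Y] for the pseudometric of [X] stands for a factorization of [Y] through [X].
    This is the form in which minimizers depend on their data. *)
Lemma pettis_comp (V W : normedModType R) (X : T -> V) (Y : T -> W) :
  pettis X ->
  (forall w (e : R), 0 < e -> exists2 r : R, 0 < r &
     forall w', `|X w - X w'| < r -> `|Y w - Y w'| < e) ->
  pettis Y.
Proof.
move=> pX XY; split; last first.
  move=> y; apply: measurable_fun_lt_sets => a; apply: (pettis_open pX) => w /= wa.
  have [r r0 H] := XY w (a - `|Y w - y|) (ltac:(by rewrite subr_gt0)).
  exists r => // w' /H; have := ler_distD (Y w) (Y w') y.
  by rewrite (distrC (Y w') (Y w)); lra.
have [[c cX] _] := pX.
(* The centres [c i] need not be values of [X], so [Y] cannot be evaluated there; [t (i, n)] is a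
   sample point whose value is near [c i], and arbitrary if there is none. *)
have /choice[t Ht] (p : nat * nat) : exists w,
    (exists w', `|X w' - c p.1| < p.2.+1%:R^-1) -> `|X w - c p.1| < p.2.+1%:R^-1.
  have [[w Hw]|n] := pselect (exists w', `|X w' - c p.1| < p.2.+1%:R^-1).
    by exists w.
  by exists point.
apply: (@separably_valuedI _ _ _ (nat * nat)%type (0, 0)%N (Y \o t)) => w e e0.
have [r r0 H] := XY w e e0.
have [n _ nr] := near_infty_natSinv_lt (PosNum (divr_gt0 r0 (ltr0Sn R 1))).
have {}nr := nr n (leqnn n); rewrite /= in nr.
have [i wi] := cX w n.+1%:R^-1 (invS_gt0 n).
exists (i, n); apply: H.
have /= := Ht (i, n) (ex_intro _ w wi).
rewrite distrC => ti; apply: le_lt_trans (ler_distD (c i) _ _) _.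
by rewrite [ltRHS]splitr ltrD //; [exact: lt_trans wi nr|exact: lt_trans ti nr].
Qed.

Lemma pettis_lipschitz (V W : normedModType R) (X : T -> V) (Y : T -> W) (k : R) :
  pettis X -> (forall w w', `|Y w - Y w'| <= k * `|X w - X w'|) -> pettis Y.
Proof.
move=> pX H; apply: (pettis_comp pX) => w e e0.
exists (e / (`|k| + 1)) => [|w' ww']; first by rewrite divr_gt0 // ltr_wpDl.
apply: le_lt_trans (H w w') _.
have k0 : 0 <= `|k| by [].
move: ww'; rewrite ltr_pdivlMr ?ltr_wpDl // => H'.
apply: le_lt_trans H'; rewrite mulrC ler_wpM2l //.
by have := ler_norm k; lra.
Qed.

Lemma pettis_cst (V : normedModType R) (x : V) : pettis (fun _ : T => x).
Proof.
split=> [|y]; last exact: measurable_cst.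
by exists (fun _ => x) => w e e0; exists 0%N; rewrite subrr normr0.
Qed.

Lemma pettis_pair (V W : normedModType R) (X : T -> V) (Y : T -> W) :
  pettis X -> pettis Y -> pettis (fun w => (X w, Y w)).
Proof.
move=> [[c cX] mX] [[c' cY] mY]; split.
  apply: (@separably_valuedI _ _ _ (nat * nat)%type (0, 0)%N
    (fun p => (c p.1, c' p.2))) => w e e0.
  have [i wi] := cX w e e0; have [j wj] := cY w e e0.
  by exists (i, j); rewrite prod_normE /= gt_max wi.
move=> [a b]; rewrite (_ : (fun _ => _) =
    (fun w => `|X w - a|) \max (fun w => `|Y w - b|)).
  exact: measurable_maxr.
by apply/funext => w; rewrite prod_normE /=.
Qed.

Lemma norm_fst_le (V W : normedModType R) (p : V * W) : `|p.1| <= `|p|.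
Proof. by rewrite prod_normE le_max lexx. Qed.

Lemma norm_snd_le (V W : normedModType R) (p : V * W) : `|p.2| <= `|p|.
Proof. by rewrite prod_normE le_max lexx orbT. Qed.

Lemma pettisD (V : normedModType R) (X Y : T -> V) :
  pettis X -> pettis Y -> pettis (fun w => X w + Y w).
Proof.
move=> pX pY; apply: (pettis_lipschitz (k := 2) (pettis_pair pX pY)) => w w'.
have := norm_fst_le ((X w, Y w) - (X w', Y w')).
have := norm_snd_le ((X w, Y w) - (X w', Y w')).
set n := `|_ - _ : V * V|.
rewrite opprD addrACA => /= H1 H2; apply: le_trans (ler_normD _ _) _; lra.
Qed.

Lemma pettisZ (V : normedModType R) (a : R) (X : T -> V) :
  pettis X -> pettis (fun w => a *: X w).
Proof.
move=> pX; apply: (pettis_lipschitz (k := `|a|) pX) => w w'.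
by rewrite -scalerBr normrZ.
Qed.

Lemma pettis_sum (V : normedModType R) (n : nat) (X : 'I_n -> T -> V) :
  (forall i, pettis (X i)) -> pettis (fun w => \sum_(i < n) X i w).
Proof.
elim: n X => [|n IH] X pX.
  rewrite (_ : (fun _ => _) = fun=> 0); first exact: pettis_cst.
  by apply/funext => w; rewrite big_ord0.
rewrite (_ : (fun _ => _) = fun w => \sum_(i < n) X (widen_ord (leqnSn n) i) w
   + X ord_max w); last by apply/funext => w; rewrite big_ord_recr.
by apply: pettisD => //; exact: IH.
Qed.

Lemma pettis_lim (V : normedModType R) (X : nat -> T -> V) (Y : T -> V) :
  (forall j, pettis (X j)) -> (forall w, X j w @[j --> \oo] --> Y w) -> pettis Y.
Proof.
move=> pX XY; split.
  have /choice[c cX] j : exists c : nat -> V,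
     forall w (e : R), 0 < e -> exists i, `|X j w - c i| < e by have [[c]] := pX j; exists c.
  apply: (@separably_valuedI _ _ _ (nat * nat)%type (0, 0)%N
    (fun p => c p.1 p.2)) => w e e0.
  have e2 : 0 < e / 2 by rewrite divr_gt0.
  have /cvgrPdist_lt/(_ _ e2)[j _ /(_ j (leqnn j)) /= wj] := XY w.
  have [i wi] := cX j w _ e2; exists (j, i) => /=.
  have := ler_distD (X j w) (Y w) (c j i); lra.
move=> y; apply: (@measurable_fun_cvg _ _ _ _ (fun j w => `|X j w - y|)).
  by move=> j; have [_] := pX j; exact.
by move=> w _; apply: cvg_norm; apply: cvgB => //; exact: cvg_cst.
Qed.

Lemma pettis_simple (V : normedModType R) (X : T -> V) :
  simple_fun X -> pettis X.
Proof.
move=> [fX mX]; split.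
  have [s sE] := (finite_seqP _).1 fX.
  exists (nth 0 s) => w e e0; exists (index (X w) s).
  rewrite nth_index ?subrr ?normr0 //.
  have : range X (X w) by exists w.
  by rewrite sE.
move=> y; apply: measurable_fun_lt_sets => a.
rewrite (_ : [set _ | _] = \bigcup_(z in range X `&` [set z | `|z - y| < a])
    X @^-1` [set z]).
  by apply: fin_bigcup_measurable => [|z _]; [exact: finite_setIl|exact: mX].
apply/seteqP; split=> [w /= wa|w [z [_ /= za] /= ->]] //.
by exists (X w) => //; split=> //; exists w.
Qed.

End StronglyMeasurable.

(** * Carathéodory functions and independence *)

Section Caratheodory.
Variables (R : realType) (d1 d2 : measure_display).
Variables (T1 : measurableType d1) (T2 : measurableType d2).

Lemma pettis_measurable_comp (V : normedModType R) (X : T2 -> V) (h : T1 -> T2) :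
  measurable_fun setT h -> pettis X -> pettis (X \o h).
Proof.
move=> mh [[c cX] mX]; split; first by exists c => w; exact: cX.
by move=> y; apply: (measurableT_comp (mX y) mh).
Qed.

Lemma pettis_caratheodory (V W : normedModType R) (X : T1 -> V)
    (G : V -> T2 -> W) :
  pettis X -> (forall u, pettis (G u)) -> (forall x, continuous (G ^~ x)) ->
  pettis (fun p : T1 * T2 => G (X p.1) p.2).
Proof.
move=> [[c cX] mX] pG cG.
have near_c (p : T1 * T2) (e : R) : 0 < e -> exists2 r : R, 0 < r &
    forall u, `|X p.1 - u| < r -> `|G (X p.1) p.2 - G u p.2| < e.
  move=> e0; have /cvgrPdist_lt/(_ _ e0)/nbhs_normP[r /= r0 H] := cG p.2 (X p.1).
  by exists r.
split.
  have /choice[c' cG'] i : exists c' : nat -> W,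
     forall x (e : R), 0 < e -> exists j, `|G (c i) x - c' j| < e.
    by have [[c']] := pG (c i); exists c'.
  apply: (@separably_valuedI _ _ _ _ (nat * nat)%type (0, 0)%N
    (fun p => c' p.1 p.2)) => p e e0.
  have e2 : 0 < e / 2 by rewrite divr_gt0.
  have [r r0 H] := near_c p _ e2.
  have [i /H pi] := cX p.1 r r0.
  have [j ij] := cG' i p.2 _ e2; exists (i, j) => /=.
  by apply: le_lt_trans (ler_distD (G (c i) p.2) _ _) _; rewrite [ltRHS]splitr ltrD.
move=> y; apply: measurable_fun_lt_sets => a.
pose B i n := [set p : T1 * T2 | `|X p.1 - c i| < n.+1%:R^-1].
pose C i m := [set p : T1 * T2 | `|G (c i) p.2 - y| <= a - m.+1%:R^-1].
(* That is: for some margin [1/(m+1)] and radius [1/(n+1)], every centre [c i] this close to [X p.1]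
   satisfies the bound with the margin. Continuity provides [n] for given [p]; conversely a centre
   close enough to [X p.1] transfers the bound back, the margin absorbing the error. *)
rewrite (_ : [set _ | _] = \bigcup_m \bigcup_n \bigcap_i (~` B i n `|` C i m)).
  apply: bigcupT_measurable => m; apply: bigcupT_measurable => n.
  apply: bigcapT_measurable => i; apply: measurableU.
    apply/measurableC/measurable_lt_set.
    exact: (measurableT_comp (mX (c i)) measurable_fst).
  apply: measurable_le_set; have [_ mG] := pG (c i).
  exact: (measurableT_comp (mG y) measurable_snd).
apply/seteqP; split=> [p /= pa|p [m _ [n _ H]] /=].
  have g0 : 0 < (a - `|G (X p.1) p.2 - y|) / 2 by rewrite divr_gt0 // subr_gt0.
  have [m _ /(_ m (leqnn m)) /= mr] := near_infty_natSinv_lt (PosNum g0).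
  have [r r0 H] := near_c p _ g0.
  have [n _ /(_ n (leqnn n)) /= nr] := near_infty_natSinv_lt (PosNum r0).
  exists m => //; exists n => // i _.
  have [Bp|nBp] := pselect (B i n p); [right|by left].
  have := H (c i) (lt_trans Bp nr); rewrite /C /=.
  have := ler_distD (G (X p.1) p.2) (G (c i) p.2) y.
  rewrite (distrC (G (c i) p.2) (G (X p.1) p.2)).
  move: mr; set q := m.+1%:R^-1; lra.
have m0 : 0 < m.+1%:R^-1 :> R by rewrite invr_gt0.
have n0 : 0 < n.+1%:R^-1 :> R by rewrite invr_gt0.
have [r r0 H'] := near_c p _ m0.
have [i pi] := cX p.1 (Num.min r n.+1%:R^-1) (ltac:(by rewrite lt_min r0)).
move: pi; rewrite lt_min => /andP[/H' pr pn].
have [//|] := H i I; rewrite /C /= => Cp.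
move: pr Cp; set q := m.+1%:R^-1 => pr Cp.
have := ler_distD (G (c i) p.2) (G (X p.1) p.2) y.
lra.
Qed.

End Caratheodory.

(** * Integration of a function of two independent variables *)

Section Independence.
Local Open Scope ereal_scope.
Variables (R : realType) (d d1 d2 : measure_display).
Variables (T : measurableType d) (P : probability T R).
Variables (T1 : measurableType d1) (T2 : measurableType d2).
Variables (X1 : {RV P >-> T1}) (X2 : {RV P >-> T2}).
Hypothesis indep : forall A B, measurable A -> measurable B ->
  P ((X1 @^-1` A) `&` (X2 @^-1` B)) = P (X1 @^-1` A) * P (X2 @^-1` B).

Let pairX w := (X1 w, X2 w).

Let mpairX : measurable_fun setT pairX.
Proof. exact: measurable_fun_pair. Qed.

Let pairX_mixin := isMeasurableFun.Build _ _ _ _ _ mpairX.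

Let joint : {RV P >-> (T1 * T2)%type} := HB.pack pairX pairX_mixin.

Let joint_distribution A : measurable A ->
  (distribution P X1 \x distribution P X2) A = distribution P joint A.
Proof. by apply: product_measure_unique => B C mB mC; rewrite -indep. Qed.

(** Independence makes the joint law a product, so Tonelli integrates over [X2] with the first
    argument frozen. This takes the place of conditioning on [X1]. *)
Lemma ge0_integral_joint_le (H : T1 * T2 -> \bar R) (c : \bar R) :
  measurable_fun setT H -> (forall p, 0 <= H p) ->
  (forall x, \int[P]_w H (x, X2 w) <= c) ->
  \int[P]_w H (X1 w, X2 w) <= c.
Proof.
move=> mH H0 Hc.
rewrite -[leLHS](ge0_integral_distribution joint mH H0).
rewrite -(eq_measure_integral _ (fun A mA _ => joint_distribution mA)).
rewrite fubini_tonelli1 //.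
have c0 : 0 <= c by apply: le_trans (Hc point); apply: integral_ge0.
apply: (@le_trans _ _ (\int[distribution P X1]_x c)).
  apply: ge0_le_integral => //.
  - by move=> x _; exact: integral_ge0.
  - exact: measurable_fun_fubini_tonelli_F.
  - move=> x _; apply: le_trans (Hc x).
    rewrite /fubini_F (ge0_integral_distribution X2 (f := fun y => H (x, y))) //.
    exact: (measurableT_comp mH (measurable_pair1 x)).
by rewrite integral_cst // [X in _ * X](_ : _ = 1) ?mule1 //; exact: probability_setT.
Qed.

Lemma integral_joint_eq0 (H : T1 * T2 -> \bar R) :
  measurable_fun setT H -> P.-integrable setT (fun w => H (X1 w, X2 w)) ->
  (forall x, P.-integrable setT (fun w => H (x, X2 w))) ->
  (forall x, \int[P]_w H (x, X2 w) = 0) ->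
  \int[P]_w H (X1 w, X2 w) = 0.
Proof.
move=> mH iH ix H0.
rewrite -[LHS](integral_distribution (X := joint) mH iH).
rewrite -(eq_measure_integral _ (fun A mA _ => joint_distribution mA)).
rewrite -integral12_prod_meas1; last first.
  apply/integrableP; split=> //.
  rewrite (eq_measure_integral _ (fun A mA _ => joint_distribution mA)).
  rewrite (ge0_integral_distribution joint) //; last exact: measurableT_comp.
  by have /integrableP[] := iH.
rewrite -[RHS](integral0 (distribution P X1) setT).
apply: eq_integral => x _; rewrite -[RHS](H0 x) /fubini_F.
rewrite (integral_distribution (X := X2) (f := fun y => H (x, y))) //.
  exact: (measurableT_comp mH (measurable_pair1 x)).
exact: ix.
Qed.

End Independence.

(** * Expectations *)

Section Means.
Variables (R : realType) (d : measure_display) (T : measurableType d).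
Variable P : probability T R.

(** Integrability is carried along with the bound because the integrands may change sign, and bounds
    on their means could not be added otherwise. *)
Definition mean_le (f : T -> R) (c : R) :=
  P.-integrable setT (EFin \o f) /\ (\int[P]_w (f w)%:E <= c%:E)%E.

Lemma mean_leD (f g : T -> R) (a b : R) :
  mean_le f a -> mean_le g b -> mean_le (fun w => f w + g w) (a + b).
Proof.
move=> [intf fa] [intg gb]; split.
  exact: (integrableD measurableT intf intg).
under eq_integral do rewrite EFinD.
by rewrite (integralD measurableT intf intg) EFinD leeD.
Qed.

Lemma mean_leZ (k : R) (f : T -> R) (a : R) : 0 <= k ->
  mean_le f a -> mean_le (fun w => k * f w) (k * a).
Proof.
move=> k0 [intf fa]; split.
  exact: (integrableZl measurableT k intf).
under eq_integral do rewrite EFinM.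
by rewrite (integralZl measurableT intf) EFinM; apply: lee_wpmul2l.
Qed.

Lemma mean_le_cst (a : R) : mean_le (fun=> a) a.
Proof.
split; first exact: (finite_measure_integrable_cst P a).
rewrite (integral_cst P measurableT a%:E) [X in (_ * X)%E](_ : _ = 1%E) ?mule1 //.
exact: probability_setT.
Qed.

Lemma mean_le_sum (n : nat) (f : 'I_n -> T -> R) (a : 'I_n -> R) :
  (forall i, mean_le (f i) (a i)) ->
  mean_le (fun w => \sum_(i < n) f i w) (\sum_(i < n) a i).
Proof.
elim: n f a => [|n IH] f a fa.
  rewrite big_ord0 (_ : (fun _ => _) = fun=> 0); first exact: mean_le_cst.
  by apply/funext => w; rewrite big_ord0.
rewrite big_ord_recr (_ : (fun _ => _) =
  fun w => \sum_(i < n) f (widen_ord (leqnSn n) i) w + f ord_max w); last first.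
  by apply/funext => w; rewrite big_ord_recr.
by apply: mean_leD => //; exact: IH.
Qed.

Lemma mean_le_trans (f : T -> R) (a b : R) : a <= b -> mean_le f a -> mean_le f b.
Proof. by move=> ab [intf fa]; split=> //; apply: le_trans fa _; rewrite lee_fin. Qed.

Lemma mean_le_dom (f g : T -> R) (a : R) : measurable_fun setT f ->
  (forall w, 0 <= f w) -> (forall w, f w <= g w) -> mean_le g a -> mean_le f a.
Proof.
move=> mf f0 fg [intg ga]; split.
  apply: (le_integrable measurableT _ _ intg); first exact/measurable_EFinP.
  move=> w _ /=; rewrite lee_fin ger0_norm // ger0_norm //.
  exact: le_trans (fg w).
apply: le_trans ga; apply: ge0_le_integral => //.
- by move=> w _; rewrite lee_fin.
- exact/measurable_EFinP.
- by have /integrableP[] := intg.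
- by move=> w _; rewrite lee_fin.
Qed.

Lemma mean_le_ge0 (f : T -> R) (a : R) : measurable_fun setT f ->
  (forall w, 0 <= f w) -> (\int[P]_w (f w)%:E <= a%:E)%E -> mean_le f a.
Proof.
move=> mf f0 fa; split=> //; apply/integrableP; split; first exact/measurable_EFinP.
under eq_integral do rewrite /= ger0_norm //.
by apply: le_lt_trans fa _; rewrite ltry.
Qed.

(* The function [f] need not be measurable: its integral is then a lower
   integral. *)
Lemma ge0_expectation_le (f g : T -> R) (a : R) :
  (forall w, 0 <= f w) -> (forall w, f w <= g w) -> mean_le g a ->
  ('E_P[f] <= a%:E)%E.
Proof.
move=> f0 fg [_ ga]; apply: le_trans ga; rewrite unlock.
have g0 w : 0 <= g w by apply: le_trans (fg w).
rewrite !ge0_integralTE => [|w|w]; rewrite ?lee_fin //.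
apply: ge_ereal_sup => _ [h /= hf <-]; apply: ereal_sup_ubound.
by exists h => //= w; apply: le_trans (hf w) _; rewrite lee_fin.
Qed.

End Means.

Section MeasurableIp.
Variables (R : realType) (U : normedModType R) (ip : {dot U for idfun}).
Hypothesis hip : norm_of_dot ip.
Variables (d : measure_display) (T : measurableType d).

Lemma pettis_measurable_norm (V : normedModType R) (X : T -> V) :
  pettis X -> measurable_fun setT (fun w => `|X w|).
Proof.
move=> [_ /(_ 0)]; congr measurable_fun; apply/funext => w; by rewrite subr0.
Qed.

Lemma pettis_measurable_sqnorm (V : normedModType R) (X : T -> V) :
  pettis X -> measurable_fun setT (fun w => `|X w| ^+ 2).
Proof. by move=> pX; apply: measurable_funX; exact: pettis_measurable_norm. Qed.

(** By polarization, since strong measurability speaks about norms only. *)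
Lemma pettis_measurable_ip (X Y : T -> U) :
  pettis X -> pettis Y -> measurable_fun setT (fun w => ip (X w) (Y w)).
Proof.
move=> pX pY.
rewrite (_ : (fun _ => _) = fun w => 4^-1 *
  (`|X w + Y w| ^+ 2 - `|X w + (-1) *: Y w| ^+ 2)).
  apply: measurable_funM => //; apply: measurable_funB.
    exact: pettis_measurable_sqnorm (pettisD pX pY).
  exact: pettis_measurable_sqnorm (pettisD pX (pettisZ (-1) pY)).
apply/funext => w; rewrite scaleN1r (normsqD hip) (normsqB hip).
by field.
Qed.

Lemma simple_expectation_ip (P : probability T R) (h : T -> U) (c : U) :
  simple_fun h -> P.-integrable setT (fun w => (ip (h w) c)%:E) /\
  (\int[P]_w (ip (h w) c)%:E)%E = (ip (simple_expectation P h) c)%:E.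
Proof.
move=> [fh mh].
pose s : seq U := finmap.enum_fset (fset_set (range h)).
have hE w : ip (h w) c = \sum_(y <- s) ip y c * \1_(h @^-1` [set y]) w.
  rewrite (bigD1_seq (h w)) /=; [| |exact: finmap.fset_uniq]; last first.
    by have := in_fset_set fh (h w); rewrite /s => ->; rewrite inE; exists w.
  rewrite indicE mem_set //= mulr1 big1 ?addr0 // => y yh.
  by rewrite indicE memNset ?mulr0 //= => /esym/eqP; apply/negP.
have int1 y : P.-integrable setT (fun w => (ip y c * \1_(h @^-1` [set y]) w)%:E).
  apply: (integrableZl measurableT (ip y c) (f := EFin \o \1_(h @^-1` [set y]))).
  exact: integrable_indic.
have E : (fun w => (ip (h w) c)%:E) =
    fun w => (\sum_(y <- s) (ip y c * \1_(h @^-1` [set y]) w)%:E)%E.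
  by apply/funext => w; rewrite hE sumEFin.
split.
  by rewrite E; apply: integrable_sum => // y _; exact: int1.
under eq_integral => w _ do rewrite hE -sumEFin.
rewrite integral_sum //.
rewrite /simple_expectation fsbig_finite //= ip_suml -sumEFin.
apply: eq_bigr => y _.
under eq_integral do rewrite EFinM.
rewrite integralZl //; last exact: integrable_indic.
rewrite integral_indic // setIT ipZl EFinM muleC fineK //.
exact: fin_num_measure.
Qed.

(** The pairing with [c] is exact on simple functions. Hence for every [j] the integral is at most
    [|c|] times the sum of the two errors of the [j]-th approximation, and both tend to 0. *)
Lemma bochner_ip_eq0 (P : probability T R) (X : T -> U) (a c : U) :
  pettis X -> bochner_expectation P X a ->
  P.-integrable setT (fun w => (ip (X w - a) c)%:E) ->
  (\int[P]_w (ip (X w - a) c)%:E = 0)%E.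
Proof.
move=> pX [h [sh _ hX ha]] iX.
have := integrable_fin_num measurableT iX.
case IE : (\int[P]_w _)%E => [I| |] // _; congr EFin.
have key j : (`|I|%:E <= `|c|%:E * ('E_P[fun w => `|X w - h j w|%R]
    + `|a - simple_expectation P (h j)|%:E))%E.
  have [ih hE] := simple_expectation_ip P c (sh j).
  have pXh : pettis (fun w => X w - h j w).
    rewrite (_ : (fun _ => _) = fun w => X w + (-1) *: h j w); last first.
      by apply/funext => w; rewrite scaleN1r.
    by apply: pettisD => //; apply: pettisZ; exact: pettis_simple (sh j).
  have mXh := pettis_measurable_norm pXh.
  have iac : P.-integrable setT (EFin \o cst (ip a c)).
    exact: (finite_measure_integrable_cst P (ip a c)).
  have iXa := integrableD measurableT iX iac.
  have E : (fun w => (ip (X w - h j w) c)%:E) =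
      ((fun w => (ip (X w - a) c)%:E) \+ (EFin \o cst (ip a c))
      \- (fun w => (ip (h j w) c)%:E))%E.
    apply/funext => w /=; rewrite -!EFinD -?EFinB; congr EFin.
    by rewrite !ipE; ring.
  have iXh : P.-integrable setT (fun w => (ip (X w - h j w) c)%:E).
    by rewrite E; apply: integrableB.
  have /integrableP[mXhc _] := iXh.
  have intXh : (\int[P]_w (ip (X w - h j w) c)%:E =
      (I + ip (a - simple_expectation P (h j)) c)%:E)%E.
    rewrite E integralB // integralD // IE hE (integral_cst P measurableT (ip a c)%:E).
    rewrite [X in (_ * X)%E](_ : _ = 1%E) ?mule1; last exact: probability_setT.
    by rewrite -!EFinD -?EFinB; congr EFin; rewrite !ipE; ring.
  have le1 : (`|\int[P]_w (ip (X w - h j w) c)%:E|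
      <= `|c|%:E * 'E_P[fun w => `|X w - h j w|%R])%E.
    apply: le_trans (le_abse_integral P measurableT _) _.
      exact: mXhc.
    have -> : (`|c|%:E * 'E_P[fun w => `|X w - h j w|%R] =
        \int[P]_w (`|c|%:E * (`|X w - h j w|)%:E))%E.
      by rewrite unlock ge0_integralZl //; exact/measurable_EFinP.
    apply: ge0_le_integral => //.
    - exact: measurableT_comp.
    - by apply: measurable_funeM; exact/measurable_EFinP.
    - move=> w Dw; rewrite -EFinM lee_fin (mulrC `|c|); exact: CauchySchwarz_norm.
  rewrite intXh abse_EFin in le1.
  rewrite muleDr //; last exact: fin_num_adde_defl.
  have le2 := CauchySchwarz_norm hip (a - simple_expectation P (h j)) c.
  apply: (@le_trans _ _ ((`|I + ip (a - simple_expectation P (h j)) c|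
     + `|a - simple_expectation P (h j)| * `|c|)%:E)).
    rewrite lee_fin; set b := ip _ _ in le2 *.
    have := ler_normB (I + b) b; rewrite addrK; lra.
  by rewrite EFinD leeD // -EFinM lee_fin mulrC.
have lim0 : (`|c|%:E * ('E_P[fun w => `|X w - h j w|%R]
    + `|a - simple_expectation P (h j)|%:E))%E @[j --> \oo] --> 0%E.
  rewrite -(mule0 `|c|%:E); apply: cvgeZl => //.
  rewrite -(adde0 0%E); apply: cvgeD => //.
  apply/fine_cvgP; split; first by apply: nearW.
  rewrite -(normr0 U) -(subrr a); apply: cvg_norm; apply: cvgB => //.
  exact: cvg_cst.
have : (`|I|%:E <= 0)%E.
  rewrite -(cvg_lim _ lim0) //; apply: lime_ge; first by apply/cvg_ex; exists 0%E.
  exact: nearW.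
by rewrite lee_fin normr_le0 => /eqP.
Qed.

End MeasurableIp.

(** * The stochastic gradient *)

Section TraceSigmaAlgebra.
Variables (dS : measure_display) (S : measurableType dS) (Xi : set S).

(* As [Xi] need not be measurable, functions that are only controlled on [Xi]
   are measured with respect to this larger sigma-algebra. *)
Definition trace_sets : set (set S) :=
  [set A | exists2 B, measurable B & A `&` Xi = B `&` Xi].

Definition traceType := g_sigma_algebraType trace_sets.

(** The trace sets already form a sigma-algebra, so generating adds nothing. *)
Lemma measurable_traceP (A : set traceType) : measurable A <-> trace_sets A.
Proof.
split; last by move=> tA; apply: sub_sigma_algebra.
apply: smallest_sub => //; split=> [|B [C mC BC]|F tF].
- by exists set0.
- exists (~` C); first exact: measurableC.
  rewrite setTD; apply/seteqP; split=> [x [nBx Xx]|x [nCx Xx]]; split=> // Cx.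
    by apply: nBx; have [] : (B `&` Xi) x by rewrite BC.
  by apply: nCx; have [] : (C `&` Xi) x by rewrite -BC.
have /choice[G GF] i : exists B, measurable B /\ F i `&` Xi = B `&` Xi.
  by have [B mB FB] := tF i; exists B.
exists (\bigcup_i G i); first by apply: bigcupT_measurable => i; have [] := GF i.
by rewrite !setI_bigcupl; apply: eq_bigcupr => i _; have [] := GF i.
Qed.

Lemma measurable_fun_trace (d : measure_display) (T : measurableType d)
    (X : T -> S) : measurable_fun setT X -> (forall w, Xi (X w)) ->
  measurable_fun setT (X : T -> traceType).
Proof.
move=> mX XXi _ A /measurable_traceP[B mB AB]; rewrite setTI.
rewrite (_ : X @^-1` A = X @^-1` B); first by rewrite -[X in measurable X]setTI; exact: mX.
apply/seteqP; split=> w /= Xw.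
  by have [] : (B `&` Xi) (X w) by rewrite -AB.
by have [] : (A `&` Xi) (X w) by rewrite AB.
Qed.

End TraceSigmaAlgebra.

Section Extension.
Variables (R : realType) (U : normedModType R).
Variables (dS : measure_display) (S : measurableType dS) (Xi : set S).

(** Samples stay in [Xi], so the value 0 is never drawn; it makes the oracle measurable in the
    sample and continuous in the point at every [x]. *)
Definition zero_extension (h : S -> U) (x : traceType Xi) : U :=
  if x \in Xi then h x else 0.

Lemma zero_extensionE h x : Xi x -> zero_extension h x = h x.
Proof. by move=> Xx; rewrite /zero_extension mem_set. Qed.

Lemma pettis_zero_extension h : strongly_measurable_on Xi h ->
  pettis (zero_extension h).
Proof.
move=> [k [sk kh]].
apply: (@pettis_lim _ _ _ _ (fun j => zero_extension (k j))) => [j|x]; last first.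
  have [xXi|xXi] := boolP (x \in Xi).
    rewrite /zero_extension xXi; apply: kh; exact: set_mem.
  by rewrite /zero_extension (negbTE xXi); exact: cvg_cst.
apply: pettis_simple; have [fk mk] := sk j; split.
  apply: (@sub_finite_set _ _ (range (k j) `|` [set 0])).
    move=> _ [x _ <-]; rewrite /zero_extension; case: ifP => _; last by right.
    by left; exists x.
  by rewrite finite_setU; split=> //; exact: finite_set1.
move=> y; apply/measurable_traceP; exists (k j @^-1` [set y]) => //.
apply/seteqP; split=> x [/= Hx Xx]; split=> //; move: Hx; rewrite /=.
  by rewrite zero_extensionE.
by rewrite zero_extensionE.
Qed.

End Extension.

(** * Mean and variance of the sampled gradient at a random point *)

Section Oracle.
Variables (R : realType) (U : normedModType R) (ip : {dot U for idfun}).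
Hypothesis hip : norm_of_dot ip.
Variables (dS : measure_display) (S : measurableType dS) (Xi : set S).
Variables (gradF : U -> S -> U) (gradf : U -> U).
Hypothesis gradF_measurable : forall u, strongly_measurable_on Xi (gradF u).
Hypothesis gradF_continuous : forall x, Xi x -> continuous (gradF ^~ x).
Hypothesis gradf_continuous : continuous gradf.

Let err (u : U) (x : traceType Xi) : U := zero_extension (gradF u) x - gradf u.

Let pettis_err u : pettis (err u).
Proof.
apply: pettisD; first exact: pettis_zero_extension.
exact: pettis_cst.
Qed.

Let continuous_err x : continuous (err ^~ x).
Proof.
move=> u; apply: cvgB; last exact: gradf_continuous.
rewrite /zero_extension; have [xXi|_] := boolP (x \in Xi); last exact: cvg_cst.
by apply: gradF_continuous; exact: set_mem.
Qed.

(** [T0] and [T1] differ because the point depends on the past of a step, while the new sample is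
    known only in the next one. *)
Lemma pettis_oracle (d0 d1 : measure_display) (T0 : measurableType d0)
    (T1 : measurableType d1) (V : T1 -> U) (X1 : T0 -> T1) (X2 : T0 -> S) :
  pettis V -> measurable_fun setT X1 -> measurable_fun setT X2 ->
  (forall w, Xi (X2 w)) ->
  pettis (fun w => gradF (V (X1 w)) (X2 w) - gradf (V (X1 w))).
Proof.
move=> pV mX1 mX2 X2Xi.
have pG := pettis_caratheodory pV pettis_err continuous_err.
have mX : measurable_fun setT (fun w => (X1 w, X2 w) : T1 * traceType Xi).
  by apply: measurable_fun_pair => //; exact: measurable_fun_trace.
have := pettis_measurable_comp mX pG; congr pettis; apply/funext => w /=.
by rewrite /err zero_extensionE.
Qed.

Variables (d : measure_display) (T : measurableType d) (P : probability T R).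
Variables (xi X2 : {RV P >-> S}).
Hypotheses (xi_in : forall w, Xi (xi w)) (X2_in : forall w, Xi (X2 w)).
Hypothesis same_law : forall A, measurable A ->
  distribution P X2 A = distribution P xi A.
Variable varrho : R.
Hypothesis unbiased : forall u, bochner_expectation P (gradF u \o xi) (gradf u).
Hypothesis variance : forall u,
  ('E_P[fun w => (`|gradF u (xi w) - gradf u| ^+ 2)%R] <= (varrho ^+ 2)%:E)%E.

Let mxi := measurable_fun_trace (measurable_funPT xi) xi_in.
Let mX2 := measurable_fun_trace (measurable_funPT X2) X2_in.

Let xi_mixin := isMeasurableFun.Build _ _ _ _ _ mxi.
Let X2_mixin := isMeasurableFun.Build _ _ _ _ _ mX2.
Let xiT : {RV P >-> traceType Xi} := HB.pack (xi : T -> traceType Xi) xi_mixin.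
Let X2T : {RV P >-> traceType Xi} := HB.pack (X2 : T -> traceType Xi) X2_mixin.

Let same_trace_law (A : set (traceType Xi)) : measurable A ->
  distribution P X2T A = distribution P xiT A.
Proof.
move=> /measurable_traceP[B mB AB].
have E (X : T -> S) : (forall w, Xi (X w)) -> X @^-1` A = X @^-1` B.
  move=> XXi; apply/seteqP; split=> w /= Xw.
    by have [] : (B `&` Xi) (X w) by rewrite -AB.
  by have [] : (A `&` Xi) (X w) by rewrite AB.
rewrite /distribution /pushforward /= (E _ X2_in) (E _ xi_in).
exact: same_law mB.
Qed.

Let errE (X : T -> S) u w : Xi (X w) -> err u (X w) = gradF u (X w) - gradf u.
Proof. by move=> ?; rewrite /err zero_extensionE. Qed.

Let mean_sq u : mean_le P (fun w => `|err u (xiT w)| ^+ 2) (varrho ^+ 2).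
Proof.
have pe := pettis_measurable_comp mxi (pettis_err u).
apply: mean_le_ge0.
- exact: pettis_measurable_sqnorm pe.
- by move=> w; exact: sqr_ge0.
- apply: le_trans (variance u); rewrite unlock.
  by under eq_integral do rewrite /= errE //.
Qed.

Let int_ip u c : P.-integrable setT (fun w => (ip (err u (xiT w)) c)%:E).
Proof.
have pe := pettis_measurable_comp mxi (pettis_err u).
have me := pettis_measurable_ip hip pe (pettis_cst _ c).
have [ig _] := mean_leD (mean_sq u) (mean_le_cst P (`|c| ^+ 2)).
apply: (le_integrable measurableT _ _ ig); first exact/measurable_EFinP.
move=> w _ /=; rewrite lee_fin; apply: le_trans (CauchySchwarz_norm hip _ _) _.
rewrite ger0_norm ?addr_ge0 ?sqr_ge0 //.
have := sqr_ge0 (`|err u (xi w)| - `|c|).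
have := sqr_ge0 `|err u (xi w)|; have := sqr_ge0 `|c|; nra.
Qed.

Let mean_ip u c : (\int[P]_w (ip (err u (xiT w)) c)%:E = 0)%E.
Proof.
have pe := pettis_measurable_comp mxi (pettis_zero_extension (gradF_measurable u)).
apply: (bochner_ip_eq0 hip pe _ (int_ip u c)).
have -> : zero_extension (gradF u) \o (xi : T -> traceType Xi) = gradF u \o xi.
  by apply/funext => w /=; rewrite zero_extensionE.
exact: unbiased.
Qed.

Let int_ipX2 u c : P.-integrable setT (fun w => (ip (err u (X2T w)) c)%:E).
Proof.
have me := pettis_measurable_ip hip (pettis_err u) (pettis_cst _ c).
have mE : measurable_fun setT (fun x => (ip (err u x) c)%:E) by exact/measurable_EFinP.
apply/integrableP; split; first exact: (measurableT_comp mE mX2).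
have mA : measurable_fun setT (fun x => `|(ip (err u x) c)%:E|)%E.
  exact: measurableT_comp.
rewrite -(ge0_integral_distribution X2T mA) //.
rewrite (eq_measure_integral _ (fun A mA _ => same_trace_law mA)).
rewrite (ge0_integral_distribution xiT mA) //.
by have /integrableP[] := int_ip u c.
Qed.

Let mean_ipX2 u c : (\int[P]_w (ip (err u (X2T w)) c)%:E = 0)%E.
Proof.
have me := pettis_measurable_ip hip (pettis_err u) (pettis_cst _ c).
have mE : measurable_fun setT (fun x => (ip (err u x) c)%:E) by exact/measurable_EFinP.
rewrite -[LHS](integral_distribution (X := X2T) mE); last exact: int_ipX2.
rewrite (eq_measure_integral _ (fun A mA _ => same_trace_law mA)).
rewrite (integral_distribution (X := xiT) mE); last exact: int_ip.
exact: mean_ip.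
Qed.

Let mean_sqX2 u : (\int[P]_w (`|err u (X2T w)| ^+ 2)%:E <= (varrho ^+ 2)%:E)%E.
Proof.
have mE : measurable_fun setT (fun x => (`|err u x| ^+ 2)%:E).
  by apply/measurable_EFinP; exact: pettis_measurable_sqnorm (pettis_err u).
rewrite -[leLHS](ge0_integral_distribution X2T mE); last by move=> x; rewrite lee_fin sqr_ge0.
rewrite (eq_measure_integral _ (fun A mA _ => same_trace_law mA)).
rewrite (ge0_integral_distribution xiT mE); last by move=> x; rewrite lee_fin sqr_ge0.
by have [] := mean_sq u.
Qed.

Variables (d1 : measure_display) (T1 : measurableType d1) (X1 : {RV P >-> T1}).
Hypothesis indep : forall A B, measurable A -> measurable B ->
  P ((X1 @^-1` A) `&` (X2 @^-1` B)) = (P (X1 @^-1` A) * P (X2 @^-1` B))%E.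

Let indepT (A : set T1) (B : set (traceType Xi)) :
  measurable A -> measurable B ->
  P ((X1 @^-1` A) `&` (X2T @^-1` B)) = (P (X1 @^-1` A) * P (X2T @^-1` B))%E.
Proof.
move=> mA /measurable_traceP[C mC BC].
have -> : X2T @^-1` B = X2 @^-1` C.
  apply/seteqP; split=> w /= Xw.
    by have [] : (C `&` Xi) (X2 w) by rewrite -BC.
  by have [] : (B `&` Xi) (X2 w) by rewrite BC.
exact: indep.
Qed.

Variables (V : T1 -> U) (pV : pettis V).

Lemma oracle_variance :
  mean_le P (fun w => `|gradF (V (X1 w)) (X2 w) - gradf (V (X1 w))| ^+ 2)
    (varrho ^+ 2).
Proof.
have pG := pettis_caratheodory pV pettis_err continuous_err.
apply: mean_le_ge0.
- apply: pettis_measurable_sqnorm; exact: (pettis_oracle pV).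
- by move=> w; exact: sqr_ge0.
pose H (p : T1 * traceType Xi) := (`|err (V p.1) p.2| ^+ 2)%:E.
rewrite (_ : (\int[P]_w _ = \int[P]_w H (X1 w, X2T w))%E); last first.
  by apply: eq_integral => w _; rewrite /H /= errE.
apply: (ge0_integral_joint_le indepT).
- by apply/measurable_EFinP; exact: pettis_measurable_sqnorm pG.
- by move=> p; rewrite lee_fin sqr_ge0.
- move=> x; rewrite /H /=; exact: (mean_sqX2 (V x)).
Qed.

(** For a frozen point the mean vanishes, so the sign of [a] is free. The second moment [c] serves
    integrability: the product is at most the sum of the squares of its factors. *)
Lemma oracle_unbiased (us : U) (a c : R) :
  mean_le P (fun w => `|V (X1 w) - us| ^+ 2) c ->
  mean_le P (fun w => a * ip (gradF (V (X1 w)) (X2 w) - gradf (V (X1 w)))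
                         (V (X1 w) - us)) 0.
Proof.
move=> cV.
have pG := pettis_caratheodory pV pettis_err continuous_err.
have pVus : pettis (fun w => V w - us) by apply: pettisD => //; exact: pettis_cst.
have mf : measurable_fun setT (X1 : T -> T1) by [].
have pe : pettis (fun w => gradF (V (X1 w)) (X2 w) - gradf (V (X1 w))).
  exact: (pettis_oracle pV).
have me := pettis_measurable_ip hip pe (pettis_measurable_comp mf pVus).
have int_ip1 : P.-integrable setT (fun w =>
    (ip (gradF (V (X1 w)) (X2 w) - gradf (V (X1 w))) (V (X1 w) - us))%:E).
  have [ig _] := mean_leD oracle_variance cV.
  apply: (le_integrable measurableT _ _ ig); first exact/measurable_EFinP.
  move=> w _ /=; rewrite lee_fin; apply: le_trans (CauchySchwarz_norm hip _ _) _.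
  rewrite ger0_norm ?addr_ge0 ?sqr_ge0 //; set x := _ - gradf _; set y := V _ - us.
  have := sqr_ge0 (`|x| - `|y|).
  have := sqr_ge0 `|x|; have := sqr_ge0 `|y|; nra.
split; first exact: (integrableZl measurableT a int_ip1).
under eq_integral do rewrite EFinM.
rewrite (integralZl measurableT int_ip1).
rewrite [X in (_ * X)%E](_ : _ = 0%E) ?mule0 //.
pose H (p : T1 * traceType Xi) := (ip (err (V p.1) p.2) (V p.1 - us))%:E.
rewrite (_ : (\int[P]_w _ = \int[P]_w H (X1 w, X2T w))%E); last first.
  by apply: eq_integral => w _; rewrite /H /= errE.
apply: (integral_joint_eq0 indepT).
- apply/measurable_EFinP; apply: (pettis_measurable_ip hip pG).
  exact: (pettis_measurable_comp measurable_fst pVus).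
- move: int_ip1; congr (_.-integrable _ _); apply/funext => w.
  by rewrite /H /= errE.
- move=> x; rewrite /H /=; exact: (int_ipX2 (V x) (V x - us)).
- move=> x; rewrite /H /=; exact: (mean_ipX2 (V x) (V x - us)).
Qed.

End Oracle.

(** * Independence of the past *)

Section Past.
Variables (R : realType) (d dS : measure_display).
Variables (T : measurableType d) (S : measurableType dS) (P : probability T R).
Variables (m : nat -> nat) (X : nat -> nat -> {RV P >-> S}).

Definition past_indices (k : nat) : seq (nat * nat) :=
  [seq (j, i) | j <- iota 0 k, i <- iota 0 (m j)].

Lemma mem_past_indices k p : (p \in past_indices k) = (p.1 < k)%N && (p.2 < m p.1)%N.
Proof.
case: p => a b /=; apply/allpairsPdep/andP => [[j [i [+ + [-> ->]]]]|[ak bm]].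
  by rewrite !mem_iota !add0n.
by exists a, b; rewrite !mem_iota !add0n.
Qed.

Lemma uniq_past_indices k : uniq (past_indices k).
Proof.
apply: allpairs_uniq_dep; rewrite ?iota_uniq //; first by move=> j _; exact: iota_uniq.
by move=> [a b] [a' b'] _ _ /= [-> ->].
Qed.

Definition cylinder k (A : nat * nat -> set S) : set T :=
  \bigcap_(p in [set` past_indices k]) (X p.1 p.2 @^-1` A p).

Definition cylinders k : set (set T) :=
  [set E | exists A, (forall p, measurable (A p)) /\ E = cylinder k A].

(** The same sample space with a coarser sigma-algebra: being [pettis] over [pastType k] expresses
    dependence on the samples before step [k]. *)
Definition pastType k := g_sigma_algebraType (cylinders k).

Lemma measurable_cylinder k : cylinders k `<=` measurable.
Proof.
move=> _ [A [mA ->]]; apply: fin_bigcap_measurable => [|p _].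
  exact: finite_seq.
by rewrite -[Y in measurable Y]setTI; exact: measurable_funPT.
Qed.

Lemma measurable_past k (A : set (pastType k)) :
  measurable A -> measurable (A : set T).
Proof.
apply: (@smallest_sub _ (sigma_algebra setT) _ (measurable : set (set T))).
  exact: sigma_algebra_measurable.
exact: measurable_cylinder.
Qed.

Lemma measurable_pastS k (A : set (pastType k)) :
  measurable A -> measurable (A : set (pastType k.+1)).
Proof.
apply: (@smallest_sub _ (sigma_algebra setT) _
    (measurable : set (set (pastType k.+1)))).
  exact: sigma_algebra_measurable.
move=> _ [A' [mA' ->]]; apply: sub_sigma_algebra.
exists (fun p => if (p.1 < k)%N then A' p else setT); split.
  by move=> p; case: ifP.
apply/seteqP; split=> w H p /=; have := H p; rewrite /= !mem_past_indices.
  by move=> H' /andP[_ pm]; case: ifP => // pk; apply: H'; rewrite pk.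
by move=> H' /andP[pk pm]; move: H'; rewrite pk ltnS ltnW //= pm; exact.
Qed.

Lemma measurable_sample k i : (i < m k)%N ->
  measurable_fun setT (X k i : pastType k.+1 -> S).
Proof.
move=> im _ B mB; rewrite setTI; apply: sub_sigma_algebra.
exists (fun p => if p == (k, i) then B else setT); split.
  by move=> p; case: ifP.
apply/seteqP; split=> w H.
  by move=> p _ /=; case: ifP => // /eqP ->.
have := H (k, i); rewrite /= mem_past_indices /= ltnSn im eqxx.
exact.
Qed.

(** The identity, read as a random variable with values in the past; it is the variable that Fubini
    freezes. *)
Definition past_id k (w : T) : pastType k := w.

Lemma measurable_past_id k : measurable_fun setT (past_id k).
Proof. by move=> _ A mA; rewrite setTI; exact: measurable_past mA. Qed.

Definition past_step k (w : pastType k.+1) : pastType k := w.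

Lemma measurable_past_step k : measurable_fun setT (past_step (k := k)).
Proof. by move=> _ A mA; rewrite setTI; exact: measurable_pastS mA. Qed.

Hypothesis indep : mutually_independent P [set p : nat * nat | (p.2 < m p.1)%N]
  (fun p => X p.1 p.2 : T -> S).

(** As functions of [A], both sides are finite measures. They agree on cylinders, which generate the
    past and are closed under intersection. *)
Lemma past_independent k i (A : set (pastType k)) (B : set S) : (i < m k)%N ->
  measurable A -> measurable B ->
  P ((A : set T) `&` (X k i @^-1` B)) = (P A * P (X k i @^-1` B))%E.
Proof.
move=> im mA mB.
have mXB : measurable (X k i @^-1` B).
  by rewrite -[Y in measurable Y]setTI; exact: measurable_funPT.
have r0 : 0 <= fine (P (X k i @^-1` B)) by rewrite fine_ge0.
pose m1 : {measure set T -> \bar R} := mrestr P mXB.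
pose m2 : {measure set T -> \bar R} := mscale (NngNum r0) P.
have m2E C : m2 C = (P C * P (X k i @^-1` B))%E.
  rewrite -[LHS]/((fine (P (X k i @^-1` B)))%:E * P C)%E fineK; first exact: muleC.
  exact: fin_num_measure.
rewrite -m2E -[LHS]/(m1 A).
have setTc : cylinders k setT.
  exists (fun=> setT); split=> //; apply/seteqP; split=> // w _ p _ //.
apply: (g_sigma_algebra_measure_unique (cylinders k) (@measurable_cylinder k)
  (fun=> setT)) => //.
- by apply/seteqP; split=> // w _; exists 0%N.
- move=> _ _ [A1 [mA1 ->]] [A2 [mA2 ->]].
  exists (fun p => A1 p `&` A2 p); split; first by move=> p; exact: measurableI.
  apply/seteqP; split=> [w [H1 H2] p pk|w H].
    by split; [exact: H1|exact: H2].
  by split=> p pk; have [] := H p pk.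
- move=> _ [A1 [mA1 ->]]; rewrite m2E /m1 /= /mrestr.
  (* Adjoining the new index with the set [B] lets mutual independence factor the whole family at
     once. *)
  pose A2 p := if p == (k, i) then B else A1 p.
  have kin : (k, i) \notin past_indices k by rewrite mem_past_indices /= ltnn.
  have E1 : P (cylinder k A1) =
      (\prod_(p <- past_indices k) P (X p.1 p.2 @^-1` A1 p))%E.
    apply: indep => //; first exact: uniq_past_indices.
    by move=> p; rewrite mem_past_indices => /andP[].
  have := @indep ((k, i) :: past_indices k) A2.
  rewrite /= kin uniq_past_indices big_cons => /(_ isT).
  rewrite (_ : \bigcap_(p in _) _ = cylinder k A1 `&` X k i @^-1` B); last first.
    apply/seteqP; split=> [w H|w [H1 H2] p /=].
      split=> [p pk|]; last by have := H (k, i); rewrite /= /A2 eqxx; apply; exact: mem_head.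
      have := H p; rewrite /= inE pk orbT => /(_ isT); rewrite /A2.
      by case: eqP => // pE; move: pk kin; rewrite pE /= => ->.
    rewrite inE /A2; case: eqP => [->//|_ /= pk]; exact: H1.
  rewrite (eq_big_seq (fun p => P (X p.1 p.2 @^-1` A1 p))) => [->|p pk].
  - by rewrite /= /A2 eqxx -E1 muleC.
  - move=> p; rewrite inE => /orP[/eqP -> //|].
    by rewrite mem_past_indices => /andP[].
  - by move=> p; rewrite /A2; case: ifP.
  - by rewrite /A2; case: eqP => // pE; move: kin; rewrite -pE pk.
- by move=> _; apply: (le_lt_trans (probability_le1 P _)); rewrite ?ltry //; exact: measurableI.
Qed.

End Past.

(** * The iteration *)

Section ArgminStability.
Variables (R : realType) (U : normedModType R) (ip : {dot U for idfun}).
Hypothesis hip : norm_of_dot ip.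

Lemma ip_le0_norm (c : R) (x y : U) : 0 < c -> ip (c *: x - y) x <= 0 ->
  c * `|x| <= `|y|.
Proof.
move=> c0; rewrite !ipE -hip => H.
have [->|x0] := eqVneq x 0; first by rewrite normr0 mulr0.
rewrite -(@ler_pM2r _ `|x|) ?normr_gt0 //.
by have := CauchySchwarz hip y x; move: H; nra.
Qed.

(** Each minimizer is tested in the variational inequality of the other, and the values of [g]
    cancel in the sum. *)
Lemma argmin_prox_monotone (g : U -> \bar R) (r : R) (l1 l2 p1 p2 x1 x2 : U) :
  eproper g -> econvex g ->
  is_argmin setT (fun x => (g x + (ip l1 x + r / 2 * `|x - p1| ^+ 2)%:E)%E) x1 ->
  is_argmin setT (fun x => (g x + (ip l2 x + r / 2 * `|x - p2| ^+ 2)%:E)%E) x2 ->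
  ip (l1 - l2 + r *: ((x1 - p1) - (x2 - p2))) (x1 - x2) <= 0.
Proof.
move=> gp gc m1 m2.
have [g1 H1] := argmin_prox_le hip x2 gp gc m1.
have [g2 H2] := argmin_prox_le hip x1 gp gc m2.
move: g1 g2 H1 H2; case: (g x1) => // a1 _; case: (g x2) => // a2 _.
by rewrite -!EFinD !lee_fin !ipE; lra.
Qed.

Lemma argmin_quadratic_monotone (C : set U) (r h : R)
    (w1 w2 p1 p2 q1 q2 x1 x2 : U) :
  convex_set (C : set (convex_lmodType U)) ->
  is_argmin C (fun x => ip w1 x + r / 2 * `|x - p1| ^+ 2
                        + h / 2 * `|x - q1| ^+ 2) x1 ->
  is_argmin C (fun x => ip w2 x + r / 2 * `|x - p2| ^+ 2
                        + h / 2 * `|x - q2| ^+ 2) x2 ->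
  ip (w1 - w2 + r *: ((x1 - p1) - (x2 - p2)) + h *: ((x1 - q1) - (x2 - q2)))
     (x1 - x2) <= 0.
Proof.
move=> Cc m1 m2; have [C1 _] := m1; have [C2 _] := m2.
have := argmin_quadratic_le hip Cc m1 C2.
have := argmin_quadratic_le hip Cc m2 C1.
by rewrite !ipE; lra.
Qed.

(** From monotonicity by Cauchy-Schwarz. It is used between two sample points for measurability, and
    against [us] for moments. *)
Lemma argmin_prox_lipschitz (g : U -> \bar R) (r : R) (l1 l2 p1 p2 x1 x2 : U) :
  0 < r -> eproper g -> econvex g ->
  is_argmin setT (fun x => (g x + (ip l1 x + r / 2 * `|x - p1| ^+ 2)%:E)%E) x1 ->
  is_argmin setT (fun x => (g x + (ip l2 x + r / 2 * `|x - p2| ^+ 2)%:E)%E) x2 ->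
  r * `|x1 - x2| <= `|l1 - l2| + r * `|p1 - p2|.
Proof.
move=> r0 gp gc m1 m2; have := argmin_prox_monotone gp gc m1 m2 => H.
apply: le_trans (ip_le0_norm (y := r *: (p1 - p2) - (l1 - l2)) r0 _) _.
  by move: H; rewrite !ipE; lra.
by apply: le_trans (ler_normB _ _) _; rewrite normrZ gtr0_norm // addrC.
Qed.

Lemma argmin_quadratic_lipschitz (C : set U) (r h : R)
    (w1 w2 p1 p2 q1 q2 x1 x2 : U) :
  0 < r -> 0 < h -> convex_set (C : set (convex_lmodType U)) ->
  is_argmin C (fun x => ip w1 x + r / 2 * `|x - p1| ^+ 2
                        + h / 2 * `|x - q1| ^+ 2) x1 ->
  is_argmin C (fun x => ip w2 x + r / 2 * `|x - p2| ^+ 2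
                        + h / 2 * `|x - q2| ^+ 2) x2 ->
  (r + h) * `|x1 - x2| <= `|w1 - w2| + r * `|p1 - p2| + h * `|q1 - q2|.
Proof.
move=> r0 h0 Cc m1 m2; have := argmin_quadratic_monotone Cc m1 m2 => H.
apply: le_trans (ip_le0_norm
  (y := r *: (p1 - p2) + h *: (q1 - q2) - (w1 - w2)) (addr_gt0 r0 h0) _) _.
  by move: H; rewrite !ipE; lra.
apply: le_trans (ler_normB _ _) _; rewrite addrC -addrA lerD2l.
by apply: le_trans (ler_normD _ _) _; rewrite !normrZ !gtr0_norm.
Qed.

Variables (Uad : set U) (gradf : U -> U) (f : U -> R) (g : U -> \bar R).
Variables (us zs lams : U).
Hypothesis g_proper : eproper g.
Hypothesis optimal : optimal_solution Uad f g us zs.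
Hypothesis multiplier : lagrange_multiplier ip Uad gradf g us zs lams.

Lemma optimal_solution_mem : Uad us /\ us = zs.
Proof. by have [] := optimal. Qed.

Let g_us : g us \is a fin_num.
Proof.
have [uad uszs] := optimal_solution_mem; have [gN _] := g_proper.
(* Were [g us] infinite, the multiplier inequality at the optimal pair would read [0 <= -oo]. *)
rewrite fin_numE gt_eqF ?gN //=; apply/eqP => gus.
by have := multiplier zs uad; rewrite -uszs gus.
Qed.

(* [us] is a fixed point of both minimization steps when the multiplier is
   [lams] and the gradient is exact. *)
Lemma optimal_argmin_prox (r : R) : 0 <= r ->
  is_argmin setT (fun x => (g x + (ip lams x + r / 2 * `|x - us| ^+ 2)%:E)%E) us.
Proof.
move=> r0; split=> // y _; have [uad uszs] := optimal_solution_mem.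
have := multiplier y uad; rewrite -uszs; have [gN _] := g_proper.
move: g_us; case: (g us) => // a _; have := gN y; case: (g y) => [b| |] // _.
  rewrite -EFinB -!EFinD !lee_fin subrr normr0 ip0r !ipE.
  have : 0 <= r / 2 * `|y - us| ^+ 2 by rewrite mulr_ge0 ?sqr_ge0 ?divr_ge0.
  rewrite expr0n /=; lra.
by move=> _; rewrite addye // leey.
Qed.

Lemma optimal_argmin_quadratic (r h : R) : 0 <= r -> 0 <= h ->
  is_argmin Uad (fun x => ip (gradf us - lams) x + r / 2 * `|x - us| ^+ 2
                          + h / 2 * `|x - us| ^+ 2) us.
Proof.
move=> r0 h0; have [uad uszs] := optimal_solution_mem; split=> // y Cy.
have := multiplier zs Cy; rewrite -uszs.
move: g_us; case: (g us) => // a _.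
rewrite -EFinB -!EFinD lee_fin !subrr add0r normr0 !ipE expr0n /=.
have : 0 <= r / 2 * `|y - us| ^+ 2 by rewrite mulr_ge0 ?sqr_ge0 ?divr_ge0.
have : 0 <= h / 2 * `|y - us| ^+ 2 by rewrite mulr_ge0 ?sqr_ge0 ?divr_ge0.
lra.
Qed.

End ArgminStability.

Section StrongConvexity.
Variables (R : realType) (U : normedModType R) (ip : {dot U for idfun}).
Hypothesis hip : norm_of_dot ip.
Variables (f : U -> R) (gradf : U -> U) (alpha L : R).
Hypothesis alpha_ge0 : 0 <= alpha.
Hypothesis f_strongly_convex : forall u v : U,
  f u + ip (gradf u) (v - u) + alpha / 2 * `|v - u| ^+ 2 <= f v.
Hypothesis gradf_lipschitz : forall u v : U,
  `|gradf u - gradf v| <= L * `|u - v|.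

(** Strong convexity is applied along the cycle [x], [o], [y], where the values of [f] cancel.
    Replacing the gradient at [y] by the one at [x] costs [L |y - x|^2]. *)
Lemma gradient_three_points (x y o : U) :
  alpha / 2 * `|x - o| ^+ 2 + alpha / 2 * `|y - o| ^+ 2 - L * `|y - x| ^+ 2
    <= ip (gradf x - gradf o) (y - o).
Proof.
have H1 := f_strongly_convex x o.
have H2 := f_strongly_convex y x.
have H3 := f_strongly_convex o y.
have H4 := CauchySchwarz hip (gradf y - gradf x) (y - x).
have H5 := gradf_lipschitz y x.
have H6 : `|gradf y - gradf x| * `|y - x| <= L * `|y - x| ^+ 2.
  by rewrite expr2 mulrA ler_wpM2r.
have H7 : 0 <= alpha / 2 * `|x - y| ^+ 2 by rewrite mulr_ge0 ?sqr_ge0 ?divr_ge0.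
move: H1 H2 H3 H4 H6 H7; rewrite (distrC o x) !ipE; lra.
Qed.

End StrongConvexity.

Section Theta.
Variables (R : realType) (theta : nat -> R).
Hypotheses (theta0 : theta 0%N = 1) (theta_gt0 : forall k, 0 < theta k.+1)
  (thetaS : forall k, theta k.+1 ^+ 2 = theta k ^+ 2 + theta k.+1).

(** Completing the square, [(theta_{k+1} - 1/2)^2 = theta_k^2 + 1/4], so each step adds at least
    [1/2]. *)
Lemma theta_ge k : 1 + k%:R / 2 <= theta k.
Proof.
elim: k => [|k IH]; first by rewrite theta0 mul0r addr0.
have t1 : 1 <= theta k by apply: le_trans IH; rewrite lerDl divr_ge0.
have := thetaS k; have := theta_gt0 k.
rewrite -natr1 mulrDl.
move: (theta k.+1) => t tp E.
have : theta k + 1 / 2 <= t.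
  rewrite leNgt; apply/negP => H.
  have : 0 < (theta k + 1 / 2 - t) * (theta k + t - 1 / 2).
    by rewrite mulr_gt0 //; lra.
  by move: E; rewrite !expr2; lra.
lra.
Qed.

Lemma theta_ge1 k : 1 <= theta k.
Proof. by apply: le_trans (theta_ge k); rewrite lerDl divr_ge0. Qed.

(* [theta_{k-1}^2], with [theta_{-1} = 0]. *)
Definition theta_pred_sq k := if k is k'.+1 then theta k' ^+ 2 else 0.

Lemma theta_pred_sqE k : theta_pred_sq k = theta k ^+ 2 - theta k.
Proof. by case: k => [|k] /=; rewrite ?theta0 ?thetaS; ring. Qed.

End Theta.

(** * Estimates along a single trajectory *)

Section Trajectory.
Variables (R : realType) (U : normedModType R) (ip : {dot U for idfun}).
Hypothesis hip : norm_of_dot ip.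
Variables (Uad : set U).
Hypothesis Uad_convex : convex_set (Uad : set (convex_lmodType U)).
Variables (f : U -> R) (gradf : U -> U) (g : U -> \bar R).
Hypotheses (g_proper : eproper g) (g_convex : econvex g).
Variables (alpha L : R).
Hypothesis f_strongly_convex : forall u v : U,
  f u + ip (gradf u) (v - u) + alpha / 2 * `|v - u| ^+ 2 <= f v.
Hypothesis gradf_lipschitz : forall u v : U,
  `|gradf u - gradf v| <= L * `|u - v|.
Variables (us zs lams : U).
Hypothesis optimal : optimal_solution Uad f g us zs.
Hypothesis multiplier : lagrange_multiplier ip Uad gradf g us zs lams.
Variables (theta : nat -> R) (mu rho eta : R).
Hypotheses (theta0 : theta 0%N = 1) (theta_gt0 : forall k, 0 < theta k.+1)
  (thetaS : forall k, theta k.+1 ^+ 2 = theta k ^+ 2 + theta k.+1).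
Hypotheses (mu01 : 0 < mu < 1) (rho0 : 0 < rho) (eta0 : 0 < eta)
  (rho_eta_le : rho + eta <= alpha) (eta_mu : eta * (1 - mu) > rho * mu).
Variables (T S : Type) (gradF : U -> S -> U) (m : nat -> nat).
Variables (xis : nat -> nat -> T -> S).
Variables (u0 z0 lam0 : U) (u z v s psi lam : nat -> T -> U).
Hypothesis admm : stochastic_admm ip Uad g gradF m xis mu
  (fun k => rho * theta k) (fun k => eta * theta k) theta
  u0 z0 lam0 u z v s psi lam.

Let th0 k : 0 < theta k.
Proof. exact: lt_le_trans ltr01 (theta_ge1 theta0 theta_gt0 thetaS k). Qed.

Let q := theta_pred_sq theta.

Lemma average_rescale k (x y : U) :
  theta k ^+ 2 *: ((1 - (theta k)^-1) *: x + (theta k)^-1 *: y) =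
  q k *: x + theta k *: y.
Proof.
rewrite scalerDr !scalerA /q theta_pred_sqE //; congr (_ *: _ + _ *: _).
  by field; rewrite gt_eqF.
by field; rewrite gt_eqF.
Qed.

(** Thus [q k *: (u k - z k)] is the running sum of the weighted residuals
    [theta_j (v_{j+1} - s_{j+1})], the same sum that drives [psi]. *)
Lemma admm_gapS k w : q k.+1 *: (u k.+1 w - z k.+1 w) =
  q k *: (u k w - z k w) + theta k *: (v k.+1 w - s k.+1 w).
Proof.
rewrite -average_rescale (admm_u admm) (admm_z admm); congr (_ *: _).
by rewrite opprD addrACA -!scalerBr.
Qed.

Lemma admm_psiE k w : psi k w = lam0 - (mu * rho) *: (q k *: (u k w - z k w)).
Proof.
elim: k => [|k IH]; first by rewrite (admm_psi0 admm) scale0r scaler0 subr0.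
rewrite (admm_psi admm) IH admm_gapS [in RHS]scalerDr opprD addrA.
by rewrite !scalerA mulrA.
Qed.

(** The factor 2 arises because [psi] contributes the gap once and the correction in [lam] once
    more: its weight [mu rho_k theta_k] is [mu rho q_{k+1}]. *)
Lemma admm_lamE k w :
  lam k w = lam0 - (2 * (mu * rho)) *: (q k *: (u k w - z k w)).
Proof.
case: k => [|k]; first by rewrite (admm_lam0 admm) scale0r scaler0 subr0.
rewrite (admm_lam admm) admm_psiE -addrA -opprD; congr (_ - _).
rewrite !scalerA -scalerDl; congr (_ *: _); rewrite /q /=; ring.
Qed.

Lemma admm_lamS k w : lam k.+1 w =
  lam k w - (2 * (mu * rho * theta k)) *: (v k.+1 w - s k.+1 w).
Proof.
rewrite !admm_lamE admm_gapS scalerDr opprD addrA; congr (_ - _).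
by rewrite scalerA; congr (_ *: _); ring.
Qed.

Definition gradient_error k w :=
  minibatch_gradient gradF m xis v k w - gradf (v k w).

Definition lyapunov k w :=
  alpha / 2 * (q k * `|u k w - us| ^+ 2)
  + (rho + eta) / 2 * (q k * `|v k w - us| ^+ 2)
  + (4 * (mu * rho))^-1 * `|lam k w - lams| ^+ 2.

Let alpha0 : 0 <= alpha.
Proof. by apply: le_trans rho_eta_le; rewrite addr_ge0 ?ltW. Qed.

Let r0 k : 0 < rho * theta k. Proof. by rewrite mulr_gt0. Qed.
Let h0 k : 0 < eta * theta k. Proof. by rewrite mulr_gt0. Qed.

Lemma lyapunovS k w : lyapunov k.+1 w <= lyapunov k w
  - theta k * ip (gradient_error k w) (v k w - us)
  + 2 / rho * `|gradient_error k w| ^+ 2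
  + Num.max 0 (L * theta k - rho / 8 * theta k ^+ 2)
    * `|v k.+1 w - v k w| ^+ 2.
Proof.
have ms := admm_s admm k w; have mv := admm_v admm k w.
have ms' := optimal_argmin_prox g_proper optimal multiplier (ltW (r0 k)).
have mv' := optimal_argmin_quadratic g_proper optimal multiplier
  (ltW (r0 k)) (ltW (h0 k)).
have HS := argmin_prox_monotone hip g_proper g_convex ms ms'.
have HV := argmin_quadratic_monotone hip Uad_convex mv mv'.
have HF := gradient_three_points hip alpha0 f_strongly_convex gradf_lipschitz
  (v k w) (v k.+1 w) us.
rewrite /lyapunov admm_lamS (admm_u admm) -/q.
set e := v k w - us; set a := v k.+1 w - v k w; set b := v k w - s k.+1 w.
have eaE : v k.+1 w - us = e + a by rewrite [RHS]addrC addrA subrK.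
have ebE : s k.+1 w - us = e - b by rewrite opprB [RHS]addrC addrA subrK.
have abE : v k.+1 w - s k.+1 w = a + b by rewrite addrA subrK.
have nbE : s k.+1 w - v k w = - b by rewrite opprB.
rewrite subrr subr0 ebE nbE in HS.
rewrite !subrr !subr0 eaE abE -/a in HV.
rewrite eaE -/e -/a in HF.
have HV' : ip (gradient_error k w + (gradf (v k w) - gradf us)
    - (lam k w - lams) + (rho * theta k) *: (a + b) + (eta * theta k) *: a)
    (e + a) <= 0.
  by move: HV; rewrite /gradient_error !ipE; lra.
have := lyapunov_step hip mu01 rho0 eta0 rho_eta_le eta_mu
  (theta_ge1 theta0 theta_gt0 thetaS k) (u k w - us) HS HV' HF.
rewrite /q [theta_pred_sq theta k.+1]/= theta_pred_sqE // eaE abE [lam k w - _ - _]addrAC.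
suff -> : (1 - (theta k)^-1) *: u k w + (theta k)^-1 *: v k.+1 w - us =
    (1 - (theta k)^-1) *: (u k w - us) + (theta k)^-1 *: (e + a) by [].
rewrite -eaE !scalerBr addrACA -opprD; congr (_ - _).
by rewrite -scalerDl subrK scale1r.
Qed.

Let lyapunov_terms_ge0 k w : [/\ 0 <= alpha / 2 * (q k * `|u k w - us| ^+ 2),
  0 <= (rho + eta) / 2 * (q k * `|v k w - us| ^+ 2) &
  0 <= (4 * (mu * rho))^-1 * `|lam k w - lams| ^+ 2].
Proof.
have q0 : 0 <= q k by rewrite /q; case: k => [|k] //=; exact: sqr_ge0.
have m0 : 0 <= mu * rho by rewrite mulr_ge0 ?ltW //; case/andP: mu01.
have re : 0 <= rho + eta by rewrite addr_ge0 ?ltW.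
split; first by rewrite !mulr_ge0 ?invr_ge0 ?sqr_ge0.
  by rewrite !mulr_ge0 ?invr_ge0 ?sqr_ge0.
by rewrite mulr_ge0 ?invr_ge0 ?sqr_ge0 // mulr_ge0.
Qed.

Lemma lyapunov_ge_u k w :
  alpha / 2 * (theta k ^+ 2 * `|u k.+1 w - us| ^+ 2) <= lyapunov k.+1 w.
Proof.
by have [_] := lyapunov_terms_ge0 k.+1 w; rewrite /lyapunov /q /=; lra.
Qed.

Lemma lyapunov_ge_lam k w :
  (4 * (mu * rho))^-1 * `|lam k w - lams| ^+ 2 <= lyapunov k w.
Proof. by have [H1 H2 _] := lyapunov_terms_ge0 k w; rewrite /lyapunov; lra. Qed.

(** From [x <= t/2 + x^2/(2t)]: the norm is bounded by an affine function of the Lyapunov function,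
    whose mean can be controlled, and [t] is arbitrary. *)
Lemma dist_u_le (t : R) k w : 0 < alpha -> 0 < t ->
  `|u k.+1 w - us| <=
  t / 2 + (alpha * t)^-1 * lyapunov k.+1 w / theta k ^+ 2.
Proof.
move=> al0 t0; have q0 : 0 < theta k ^+ 2 by rewrite exprn_gt0.
have := lyapunov_ge_u k w; set W := lyapunov _ _; set x := `|_ - _|.
move=> H; apply: (@le_trans _ _ (t / 2 + (2 * t)^-1 * x ^+ 2)).
  rewrite -subr_ge0 (_ : _ - _ = (2 * t)^-1 * (t - x) ^+ 2).
    by rewrite mulr_ge0 ?sqr_ge0 // invr_ge0 mulr_ge0 // ltW.
  by field; rewrite gt_eqF.
rewrite lerD2l ler_pdivlMr //.
have -> : (2 * t)^-1 * x ^+ 2 * theta k ^+ 2 =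
    (alpha * t)^-1 * (alpha / 2 * (theta k ^+ 2 * x ^+ 2)).
  by field; rewrite !gt_eqF.
by rewrite ler_pM2l // invr_gt0 mulr_gt0.
Qed.

(** By [admm_lamE], [u - z] is [(lam0 - lam) / (2 mu rho theta_k^2)]. With [x <= 1 + x^2] and
    [|lam - lams|^2 <= 4 mu rho W], division by [2 mu rho] gives the coefficient 2. *)
Lemma dist_z_le k w : `|z k.+1 w - us| <= `|u k.+1 w - us|
  + ((2 * (mu * rho))^-1 * (`|lam0 - lams| + 1) + 2 * lyapunov k.+1 w)
    / theta k ^+ 2.
Proof.
have q0 : 0 < theta k ^+ 2 by rewrite exprn_gt0.
have /andP[mu0 _] := mu01.
have mr0 : 0 < mu * rho by rewrite mulr_gt0.
rewrite (_ : z k.+1 w - us = (u k.+1 w - us) - (u k.+1 w - z k.+1 w)); last first.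
  by rewrite opprB [RHS]addrC addrA subrK.
apply: le_trans (ler_normB _ _) _; rewrite lerD2l ler_pdivlMr //.
have E : lam0 - lam k.+1 w =
    (2 * (mu * rho) * theta k ^+ 2) *: (u k.+1 w - z k.+1 w).
  by rewrite admm_lamE opprB addrC subrK scalerA.
have := congr1 Num.norm E; rewrite normrZ gtr0_norm ?mulr_gt0 // => {}E.
have := ler_distD lams lam0 (lam k.+1 w); rewrite (distrC lams) E => H.
have HW := lyapunov_ge_lam k.+1 w.
have H2 : `|lam k.+1 w - lams| <= 1 + `|lam k.+1 w - lams| ^+ 2.
  have := sqr_ge0 (`|lam k.+1 w - lams| - 1); have := sqr_ge0 `|lam k.+1 w - lams|.
  by rewrite !expr2; nra.
pose c := 2 * (mu * rho); have c0 : 0 < c by rewrite mulr_gt0.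
rewrite -/c -(ler_pM2l c0).
have -> : c * (c^-1 * (`|lam0 - lams| + 1) + 2 * lyapunov k.+1 w) =
    `|lam0 - lams| + 1 + 2 * c * lyapunov k.+1 w.
  by field; rewrite !gt_eqF.
move: HW; rewrite ler_pdivrMl ?mulr_gt0 // => HW.
by move: H H2 HW; rewrite /c; lra.
Qed.

Lemma admm_s_lipschitz k w w' :
  rho * theta k * `|s k.+1 w - s k.+1 w'| <=
  `|lam k w - lam k w'| + rho * theta k * `|v k w - v k w'|.
Proof.
exact: (argmin_prox_lipschitz hip (r0 k) g_proper g_convex (admm_s admm k w)
  (admm_s admm k w')).
Qed.

Let G k w := minibatch_gradient gradF m xis v k w.

Lemma admm_v_lipschitz k w w' :
  (rho * theta k + eta * theta k) * `|v k.+1 w - v k.+1 w'| <=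
  `|(G k w - lam k w) - (G k w' - lam k w')|
  + rho * theta k * `|s k.+1 w - s k.+1 w'| + eta * theta k * `|v k w - v k w'|.
Proof.
exact: (argmin_quadratic_lipschitz hip (r0 k) (h0 k) Uad_convex
  (admm_v admm k w) (admm_v admm k w')).
Qed.

(** [us] is a fixed point of both Lipschitz steps. [C] may depend on [k], since it only serves to
    keep second moments finite from one step to the next. *)
Lemma admm_growth k : exists2 C : R, 0 <= C & forall w,
  `|v k.+1 w - us| + `|lam k.+1 w - lams| <=
  C * (`|v k w - us| + `|lam k w - lams| + `|gradient_error k w|).
Proof.
set r := rho * theta k; set h := eta * theta k.
have rk : 0 < r := r0 k; have hk : 0 < h := h0 k.
have rh : 0 < r + h by rewrite addr_gt0.
have /andP[mu0 _] := mu01.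
have mr0 : 0 < mu * rho by rewrite mulr_gt0.
pose c := 2 * (mu * rho * theta k).
have c0 : 0 < c by rewrite !mulr_gt0.
(* [D] and [E] bound the distances of [s_{k+1}] and [v_{k+1}] to [us] relative to [A]. *)
pose D := 1 + r^-1.
pose E := (r + h)^-1 * (2 + `|L| + r * D + h).
have D0 : 0 <= D by rewrite addr_ge0 // invr_ge0 ltW.
have E0 : 0 <= E.
  have rD : 0 <= r * D by rewrite mulr_ge0 // ltW.
  have i0 : 0 <= (r + h)^-1 by rewrite invr_ge0 ltW.
  by rewrite mulr_ge0 // !addr_ge0 // ltW.
have cED : 0 <= c * (E + D) := mulr_ge0 (ltW c0) (addr_ge0 E0 D0).
have C0 : 0 <= E + 1 + c * (E + D) := addr_ge0 (addr_ge0 E0 ler01) cED.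
exists (E + 1 + c * (E + D)) => //.
move=> w.
set A := _ + _ + `|gradient_error k w|.
have A1 : 0 <= `|v k w - us| by []; have A2 : 0 <= `|lam k w - lams| by [].
have A3 : 0 <= `|gradient_error k w| by [].
have A0 : 0 <= A by rewrite !addr_ge0.
have ms' := optimal_argmin_prox g_proper optimal multiplier (ltW rk).
have mv' := optimal_argmin_quadratic g_proper optimal multiplier (ltW rk) (ltW hk).
have HS := argmin_prox_lipschitz hip rk g_proper g_convex (admm_s admm k w) ms'.
have HV := argmin_quadratic_lipschitz hip rk hk Uad_convex (admm_v admm k w) mv'.
have {}HS : `|s k.+1 w - us| <= D * A.
  rewrite -(@ler_pM2l _ r) //; apply: le_trans HS _.
  have -> : r * (D * A) = A + r * A by rewrite /D; field; rewrite gt_eqF.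
  apply: lerD; first by rewrite /A; lra.
  by rewrite ler_pM2l // /A; lra.
have HG : `|G k w - lam k w - (gradf us - lams)| <= (2 + `|L|) * A.
  rewrite (_ : _ - _ = gradient_error k w + (gradf (v k w) - gradf us)
     - (lam k w - lams)); last first.
    rewrite /gradient_error -/(G k w) addrA subrK.
    by rewrite !opprB addrACA [RHS]addrACA; congr (_ + _); rewrite addrC.
  apply: le_trans (ler_normB _ _) _.
  have := ler_normD (gradient_error k w) (gradf (v k w) - gradf us).
  have := gradf_lipschitz (v k w) us.
  have : L * `|v k w - us| <= `|L| * A.
    apply: (@le_trans _ _ (`|L| * `|v k w - us|)).
      by rewrite ler_wpM2r // ler_norm.
    by rewrite ler_wpM2l // /A; lra.
  have : `|gradient_error k w| + `|lam k w - lams| <= A by rewrite /A; lra.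
  by lra.
have {}HV : `|v k.+1 w - us| <= E * A.
  rewrite -(@ler_pM2l _ (r + h)) //; apply: le_trans HV _.
  have -> : (r + h) * (E * A) = (2 + `|L|) * A + r * (D * A) + h * A.
    by rewrite /E; field; rewrite gt_eqF.
  apply: lerD; last by rewrite ler_pM2l // /A; lra.
  by apply: lerD => //; rewrite ler_pM2l.
have HL : `|lam k.+1 w - lams| <= A + c * ((E + D) * A).
  rewrite admm_lamS addrAC; apply: le_trans (ler_normB _ _) _.
  rewrite normrZ gtr0_norm // lerD //; first by rewrite /A; lra.
  rewrite ler_pM2l // mulrDl; apply: le_trans _ (lerD HV HS).
  by rewrite (distrC (s k.+1 w)); exact: ler_distD.
have -> : (E + 1 + c * (E + D)) * A = E * A + (A + c * ((E + D) * A)) by ring.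
exact: lerD.
Qed.

End Trajectory.

Lemma pettis_fst (R : realType) (d : measure_display) (T : measurableType d)
    (V W : normedModType R) (X : T -> V * W) :
  pettis X -> pettis (fun w => (X w).1).
Proof.
move=> pX; apply: (pettis_lipschitz (k := 1) pX) => w w'.
by rewrite mul1r; exact: (norm_fst_le (X w - X w')).
Qed.

Lemma pettis_snd (R : realType) (d : measure_display) (T : measurableType d)
    (V W : normedModType R) (X : T -> V * W) :
  pettis X -> pettis (fun w => (X w).2).
Proof.
move=> pX; apply: (pettis_lipschitz (k := 1) pX) => w w'.
by rewrite mul1r; exact: (norm_snd_le (X w - X w')).
Qed.

Lemma pettisB (R : realType) (d : measure_display) (T : measurableType d)
    (V : normedModType R) (X Y : T -> V) :
  pettis X -> pettis Y -> pettis (fun w => X w - Y w).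
Proof.
move=> pX pY; rewrite (_ : (fun _ => _) = fun w => X w + (-1) *: Y w).
  by apply: pettisD => //; exact: pettisZ.
by apply/funext => w; rewrite scaleN1r.
Qed.

(** Nonnegativity of the sum of squared deviations from the mean [M]. *)
Lemma sqnorm_mean_le (R : realType) (U : normedModType R)
    (ip : {dot U for idfun}) (hip : norm_of_dot ip) (n : nat) (x : 'I_n -> U) :
  (0 < n)%N ->
  `|n%:R^-1 *: \sum_(i < n) x i| ^+ 2 <= n%:R^-1 * \sum_(i < n) `|x i| ^+ 2.
Proof.
move=> n0; set M := _ *: _.
have nR : 0 < n%:R :> R by rewrite ltr0n.
have E : \sum_(i < n) x i = n%:R *: M.
  by rewrite /M scalerA divff ?gt_eqF // scale1r.
have : 0 <= \sum_(i < n) `|x i - M| ^+ 2.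
  by apply: sumr_ge0 => i _; exact: sqr_ge0.
under eq_bigr do rewrite (normsqB hip).
rewrite big_split sumrB /= -mulr_sumr -ip_suml E ipZl -hip.
rewrite sumr_const card_ord -mulr_natl => H.
rewrite ler_pdivlMl //; lra.
Qed.

(** * Measurability, moments and mean growth of the iteration *)

Section StochasticTrajectory.
Variables (R : realType) (U : normedModType R) (ip : {dot U for idfun}).
Hypothesis hip : norm_of_dot ip.
Variables (Uad : set U).
Hypothesis Uad_convex : convex_set (Uad : set (convex_lmodType U)).
Variables (f : U -> R) (gradf : U -> U) (g : U -> \bar R).
Hypotheses (g_proper : eproper g) (g_convex : econvex g).
Variables (alpha L : R).
Hypothesis f_strongly_convex : forall u v : U,
  f u + ip (gradf u) (v - u) + alpha / 2 * `|v - u| ^+ 2 <= f v.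
Hypothesis gradf_lipschitz : forall u v : U,
  `|gradf u - gradf v| <= L * `|u - v|.
Variables (us zs lams : U).
Hypothesis optimal : optimal_solution Uad f g us zs.
Hypothesis multiplier : lagrange_multiplier ip Uad gradf g us zs lams.
Variables (theta : nat -> R) (mu rho eta : R).
Hypotheses (theta0 : theta 0%N = 1) (theta_gt0 : forall k, 0 < theta k.+1)
  (thetaS : forall k, theta k.+1 ^+ 2 = theta k ^+ 2 + theta k.+1).
Hypotheses (mu01 : 0 < mu < 1) (rho0 : 0 < rho) (eta0 : 0 < eta)
  (rho_eta_le : rho + eta <= alpha) (eta_mu : eta * (1 - mu) > rho * mu).
Variables (d dS : measure_display) (T : measurableType d) (S : measurableType dS).
Variables (P : probability T R) (Xi : set S) (gradF : U -> S -> U).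
Hypothesis gradF_measurable : forall u, strongly_measurable_on Xi (gradF u).
Hypothesis gradF_continuous : forall x, Xi x -> continuous (gradF ^~ x).
Variable xi : {RV P >-> S}.
Hypothesis xi_in : forall w, Xi (xi w).
Variable varrho : R.
Hypothesis unbiased : forall u, bochner_expectation P (gradF u \o xi) (gradf u).
Hypothesis variance : forall u,
  ('E_P[fun w => (`|gradF u (xi w) - gradf u| ^+ 2)%R] <= (varrho ^+ 2)%:E)%E.
Variables (m : nat -> nat) (xis : nat -> nat -> {RV P >-> S}).
Hypothesis m_gt0 : forall k, (0 < m k)%N.
Hypothesis xis_in : forall k i w, (i < m k)%N -> Xi (xis k i w).
Hypothesis xis_law : forall k i (A : set S), (i < m k)%N -> measurable A ->
  distribution P (xis k i) A = distribution P xi A.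
Hypothesis xis_indep : mutually_independent P
  [set p : nat * nat | (p.2 < m p.1)%N] (fun p => xis p.1 p.2 : T -> S).
Variables (u0 z0 lam0 : U) (u z v s psi lam : nat -> T -> U).
Hypothesis admm : stochastic_admm ip Uad g gradF m
  (fun k i => xis k i : T -> S) mu
  (fun k => rho * theta k) (fun k => eta * theta k) theta
  u0 z0 lam0 u z v s psi lam.

Let err k w := gradient_error gradf gradF m (fun k i => xis k i : T -> S) v k w.
Let W k w := lyapunov alpha us lams theta mu rho eta u v lam k w.

Let past k := pastType m xis k.

Let th0 k : 0 < theta k.
Proof. exact: lt_le_trans ltr01 (theta_ge1 theta0 theta_gt0 thetaS k). Qed.

(** The pair [(v, lam)] is a full state: by [admm_lamS], it and the new samples determine the next
    [s], [v] and [lam]. *)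
Definition adapted_L2 k := pettis (fun w : past k => (v k w, lam k w)) /\
  exists c, mean_le P (fun w => `|v k w - us| ^+ 2) c /\
            mean_le P (fun w => `|lam k w - lams| ^+ 2) c.

Let gradf_continuous : continuous gradf.
Proof.
move=> x; apply/cvgrPdist_lt => e e0.
apply/nbhs_normP; exists (e / (`|L| + 1)) => /= [|y].
  by rewrite divr_gt0 // ltr_wpDl.
rewrite /ball_ /= ltr_pdivlMr ?ltr_wpDl // => H.
apply: le_lt_trans (gradf_lipschitz x y) _; apply: le_lt_trans H.
rewrite mulrC ler_wpM2l //; have := ler_norm L; lra.
Qed.

Let mX1 k := isMeasurableFun.Build _ _ _ _ _ (@measurable_past_id _ _ _ _ _ P m xis k).
Let X1 k : {RV P >-> past k} := HB.pack (@past_id _ _ _ _ _ P m xis k) (mX1 k).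

Let sample_err k i w := gradF (v k w) (xis k i w) - gradf (v k w).

Let errE k w : err k w = (m k)%:R^-1 *: \sum_(i < m k) sample_err k i w.
Proof.
rewrite /err /gradient_error /minibatch_gradient /sample_err sumrB scalerBr.
rewrite sumr_const card_ord -(scaler_nat (m k) (gradf _)) scalerA.
by rewrite mulVf ?scale1r // pnatr_eq0 -lt0n m_gt0.
Qed.

Section Step.
Variables (k : nat) (Hk : adapted_L2 k).

Let pv : pettis (fun w : past k => v k w).
Proof. by have [pX _] := Hk; exact: (pettis_fst pX). Qed.

Let indep i (im : (i < m k)%N) (A : set (past k)) (B : set S) :
  measurable A -> measurable B ->
  P ((X1 k @^-1` A) `&` (xis k i @^-1` B)) =
  (P (X1 k @^-1` A) * P (xis k i @^-1` B))%E.
Proof. move=> mA mB; exact: (past_independent xis_indep im mA mB). Qed.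

Let pettis_sample_err i : (i < m k)%N ->
  pettis (fun w : past k.+1 => sample_err k i w).
Proof.
move=> im; exact: (pettis_oracle gradF_measurable gradF_continuous
  gradf_continuous pv (@measurable_past_step _ _ _ _ _ P m xis k)
  (measurable_sample (X := xis) im) (fun w => xis_in w im)).
Qed.

Let pettis_err : pettis (fun w : past k.+1 => err k w).
Proof.
rewrite (_ : (fun _ => _) = fun w : past k.+1 =>
    (m k)%:R^-1 *: \sum_(i < m k) sample_err k i w).
  by apply: pettisZ; apply: pettis_sum => i; exact: pettis_sample_err.
by apply/funext => w; rewrite errE.
Qed.

Let measurable_sq j (X : T -> U) : pettis (X : past j -> U) ->
  measurable_fun setT (fun w : T => `|X w| ^+ 2).
Proof.
move=> pX; apply: pettis_measurable_sqnorm.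
exact: (pettis_measurable_comp (@measurable_past_id _ _ _ _ _ P m xis j) pX).
Qed.

Lemma gradient_error_variance : mean_le P (fun w => `|err k w| ^+ 2) (varrho ^+ 2).
Proof.
have H (i : 'I_(m k)) : mean_le P (fun w => `|sample_err k i w| ^+ 2) (varrho ^+ 2).
  exact: (oracle_variance gradF_measurable gradF_continuous gradf_continuous
    xi_in (fun w => xis_in w (ltn_ord i))
    (fun A => xis_law (ltn_ord i)) variance (indep (ltn_ord i)) pv).
have m0 : 0 <= (m k)%:R^-1 :> R by rewrite invr_ge0.
have := mean_leZ m0 (mean_le_sum H).
rewrite sumr_const card_ord -(mulr_natl (varrho ^+ 2)) mulrA mulVf ?mul1r; last first.
  by rewrite pnatr_eq0 -lt0n m_gt0.
apply: mean_le_dom => [|w|w]; first exact: measurable_sq pettis_err.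
  exact: sqr_ge0.
by rewrite errE; exact: (sqnorm_mean_le hip).
Qed.

Lemma gradient_error_unbiased (a : R) :
  mean_le P (fun w => a * ip (err k w) (v k w - us)) 0.
Proof.
have [_ [c [cv _]]] := Hk.
have H (i : 'I_(m k)) : mean_le P
    (fun w => a / (m k)%:R * ip (sample_err k i w) (v k w - us)) 0.
  exact: (oracle_unbiased hip gradF_measurable gradF_continuous gradf_continuous
    xi_in (fun w => xis_in w (ltn_ord i))
    (fun A => xis_law (ltn_ord i)) unbiased variance (indep (ltn_ord i)) pv
    (us := us) _ cv).
have := mean_le_sum H; rewrite big1 //.
congr mean_le; apply/funext => w.
by rewrite errE ipZl ip_suml mulrA mulr_sumr.
Qed.

Let pettis_next : pettis (fun w : past k.+1 => (v k.+1 w, lam k.+1 w)).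
Proof.
have [pX _] := Hk.
have {}pX : pettis (fun w : past k.+1 => (v k w, lam k w)).
  exact: (pettis_measurable_comp (@measurable_past_step _ _ _ _ _ P m xis k) pX).
have r0 : 0 < rho * theta k by rewrite mulr_gt0.
have h0 : 0 < eta * theta k by rewrite mulr_gt0.
have pvk : pettis (fun w : past k.+1 => v k w) := pettis_fst pX.
have plam : pettis (fun w : past k.+1 => lam k w) := pettis_snd pX.
have ps : pettis (fun w : past k.+1 => s k.+1 w).
  apply: (pettis_lipschitz (k := (rho * theta k)^-1 * (1 + rho * theta k)) pX).
  move=> w w'; rewrite -mulrA ler_pdivlMl //.
  apply: le_trans (admm_s_lipschitz hip g_proper g_convex theta0 theta_gt0
    thetaS rho0 admm k w w') _.
  rewrite mulrDl mul1r; apply: lerD; first exact: (norm_snd_le ((v k w, lam k w) - (v k w', lam k w'))).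
  by rewrite ler_pM2l //; exact: (norm_fst_le ((v k w, lam k w) - (v k w', lam k w'))).
have pG : pettis (fun w : past k.+1 =>
    minibatch_gradient gradF m (fun k i => xis k i : T -> S) v k w - lam k w).
  rewrite (_ : (fun _ => _) = fun w : past k.+1 => err k w + gradf (v k w) - lam k w).
    apply: pettisB => //; apply: pettisD => //.
    by apply: (pettis_lipschitz pvk) => w w'; exact: gradf_lipschitz.
  by apply/funext => w; rewrite /err /gradient_error subrK.
have pY := pettis_pair (pettis_pair pG ps) pvk.
have pvS : pettis (fun w : past k.+1 => v k.+1 w).
  apply: (pettis_lipschitz (k := (rho * theta k + eta * theta k)^-1 *
    (1 + rho * theta k + eta * theta k)) pY).
  move=> w w'; rewrite -mulrA ler_pdivlMl ?addr_gt0 //.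
  apply: le_trans (admm_v_lipschitz hip Uad_convex theta0 theta_gt0
    thetaS rho0 eta0 admm k w w') _.
  set D := _ - _ : (U * U) * U.
  have D1 := norm_fst_le D; have D2 := norm_snd_le D.
  have D11 := norm_fst_le D.1; have D12 := norm_snd_le D.1.
  rewrite 2!mulrDl mul1r; apply: lerD; last by rewrite ler_pM2l.
  by apply: lerD; [exact: le_trans D11 D1|rewrite ler_pM2l //; exact: le_trans D12 D1].
apply: pettis_pair => //.
rewrite (_ : lam k.+1 = fun w : past k.+1 =>
    lam k w - (2 * (mu * rho * theta k)) *: (v k.+1 w - s k.+1 w)).
  by apply: pettisB => //; apply: pettisZ; exact: pettisB.
by apply/funext => w; rewrite (admm_lamS theta0 theta_gt0 thetaS admm).
Qed.

Lemma adapted_L2S : adapted_L2 k.+1.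
Proof.
split; first exact: pettis_next.
have [_ [c [cv cl]]] := Hk.
have [C C0 HC] := admm_growth hip Uad_convex g_proper g_convex gradf_lipschitz
  optimal multiplier theta0 theta_gt0 thetaS mu01 rho0 eta0 admm k.
have M := mean_leZ (mulr_ge0 (ler0n R 3) (sqr_ge0 C))
  (mean_leD (mean_leD cv cl) gradient_error_variance).
have HM w : (`|v k.+1 w - us| + `|lam k.+1 w - lams|) ^+ 2 <=
    3 * C ^+ 2 * (`|v k w - us| ^+ 2 + `|lam k w - lams| ^+ 2 + `|err k w| ^+ 2).
  have := HC w; rewrite -/(err k w); set A := _ + _ + _ => H.
  apply: (@le_trans _ _ ((C * A) ^+ 2)).
    by rewrite lerXn2r // nnegrE ?addr_ge0 // mulr_ge0 // !addr_ge0.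
  rewrite /A exprMn; move: (`|v k w - us|) (`|lam k w - lams|) (`|err k w|) => a b e.
  have -> : 3 * C ^+ 2 * (a ^+ 2 + b ^+ 2 + e ^+ 2) =
      C ^+ 2 * (3 * (a ^+ 2 + b ^+ 2 + e ^+ 2)) by ring.
  apply: ler_wpM2l; first exact: sqr_ge0.
  have := sqr_ge0 (a - b); have := sqr_ge0 (a - e); have := sqr_ge0 (b - e).
  by rewrite !expr2; lra.
have pS := pettis_next.
exists (3 * C ^+ 2 * (c + c + varrho ^+ 2)); split.
  apply: mean_le_dom M => [|w|w]; last 2 first.
  - exact: sqr_ge0.
  - apply: le_trans (HM w).
    by rewrite lerXn2r ?nnegrE ?addr_ge0 // lerDl.
  by apply: measurable_sq; apply: pettisB; [exact: pettis_fst pS|exact: pettis_cst].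
apply: mean_le_dom M => [|w|w]; last 2 first.
- exact: sqr_ge0.
- apply: le_trans (HM w).
  by rewrite lerXn2r ?nnegrE ?addr_ge0 // lerDr.
by apply: measurable_sq; apply: pettisB; [exact: pettis_snd pS|exact: pettis_cst].
Qed.

(** Only finiteness matters, as this mean is multiplied by [drift k], which vanishes for large
    [k]. *)
Lemma increment_L2 : exists c, mean_le P (fun w => `|v k.+1 w - v k w| ^+ 2) c.
Proof.
have [_ [c [cv _]]] := Hk; have [pS [c' [cv' _]]] := adapted_L2S.
have M := mean_leZ (ler0n R 2) (mean_leD cv cv').
eexists; apply: mean_le_dom M => [|w|w].
- apply: measurable_sq; apply: pettisB; first exact: pettis_fst pS.
  exact: (pettis_measurable_comp (@measurable_past_step _ _ _ _ _ P m xis k) pv).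
- exact: sqr_ge0.
rewrite (_ : v k.+1 w - v k w = (v k.+1 w - us) - (v k w - us)); last first.
  by rewrite opprB addrA subrK.
move: (v k.+1 w - us) (v k w - us) => x y.
have := sqr_ge0 `|x + y|.
by rewrite (normsqD hip) (normsqB hip x y); lra.
Qed.

End Step.

Lemma adapted_L2_all k : adapted_L2 k.
Proof.
elim: k => [|k]; last exact: adapted_L2S.
split.
  rewrite (_ : (fun _ => _) = fun=> (u0, lam0)); first exact: pettis_cst.
  by apply/funext => w; rewrite (admm_v0 admm) (admm_lam0 admm).
exists (`|u0 - us| ^+ 2 + `|lam0 - lams| ^+ 2); split.
  rewrite (_ : (fun _ => _) = fun=> `|u0 - us| ^+ 2).
    by apply: mean_le_trans (mean_le_cst P _); rewrite lerDl sqr_ge0.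
  by apply/funext => w; rewrite (admm_v0 admm).
rewrite (_ : (fun _ => _) = fun=> `|lam0 - lams| ^+ 2).
  by apply: mean_le_trans (mean_le_cst P _); rewrite lerDr sqr_ge0.
by apply/funext => w; rewrite (admm_lam0 admm).
Qed.

Let drift k : R := Num.max 0 (L * theta k - rho / 8 * theta k ^+ 2).

Let drift_eventually0 : exists N, forall k, (N <= k)%N -> drift k = 0.
Proof.
(* From [k >= 16 L / rho] and [theta k >= k / 2] follows [rho / 8 * theta k >= L]. *)
have [N _ HN] := nbhs_infty_ger (16 * L / rho).
exists N => k /HN /= Hk; apply/max_idPl.
have tk : k%:R / 2 <= theta k.
  by apply: le_trans (theta_ge theta0 theta_gt0 thetaS k); rewrite lerDr.
have Lk : L <= rho / 8 * theta k.
  by move: Hk; rewrite ler_pdivrMr //; move: tk; rewrite -(ler_pM2l rho0); lra.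
by have := ler_wpM2r (ltW (th0 k)) Lk; rewrite expr2; lra.
Qed.

Lemma eventually0_sum_bounded (x : nat -> R) N : (forall k, 0 <= x k) ->
  (forall k, (N <= k)%N -> x k = 0) ->
  forall K, \sum_(k < K) x k <= \sum_(k < N) x k.
Proof.
move=> x0 xN K; rewrite -!(big_mkord xpredT x).
have [KN|/ltnW NK] := leqP K N.
  by rewrite [leRHS](big_cat_nat (leq0n K) KN) //= lerDl sumr_ge0.
rewrite (big_cat_nat (leq0n N) NK) //= gerDl big_nat_cond big1 // => k.
by rewrite andbT => /andP[Nk _]; exact: xN.
Qed.

(** The majorant [G] adds up the right-hand sides of [lyapunovS], which are integrable, so
    measurability of [W K] never comes up. *)
Lemma lyapunov_mean_growth : exists A B : R, [/\ 0 <= A, 0 <= B &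
  forall K, exists2 G : T -> R, (forall w, W K w <= G w) &
    mean_le P G (A + B * K%:R)].
Proof.
have /choice[M HM] k : exists c, 0 <= c /\
    mean_le P (fun w => `|v k.+1 w - v k w| ^+ 2) c.
  have [c Hc] := increment_L2 (adapted_L2_all k).
  exists `|c|; split=> //; apply: mean_le_trans Hc; exact: ler_norm.
pose x k := drift k * M k.
have dr0 k : 0 <= drift k by rewrite le_max lexx.
have x0 k : 0 <= x k by rewrite mulr_ge0 //; case: (HM k).
have [N HN] := drift_eventually0.
have xN k : (N <= k)%N -> x k = 0 by move=> Nk; rewrite /x HN // mul0r.
have sum_x := eventually0_sum_bounded x0 xN.
pose w0 := (4 * (mu * rho))^-1 * `|lam0 - lams| ^+ 2.
have m0 : 0 < mu by case/andP: mu01.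
have w00 : 0 <= w0 by rewrite mulr_ge0 ?sqr_ge0 // invr_ge0 ltW // !mulr_gt0.
pose B := 2 / rho * varrho ^+ 2.
have rho2 : 0 <= 2 / rho by rewrite divr_ge0 // ltW.
have B0 : 0 <= B by rewrite mulr_ge0 // sqr_ge0.
exists (w0 + \sum_(k < N) x k), B; split=> //.
  by rewrite addr_ge0 // sumr_ge0.
move=> K.
(* The induction keeps the partial sums of the drift terms; the sum over the first [N] steps bounds
   them all. *)
suff [G HG mG] : exists2 G : T -> R, (forall w, W K w <= G w) &
    mean_le P G (w0 + \sum_(k < K) x k + B * K%:R).
  by exists G => //; apply: mean_le_trans mG; rewrite lerD2r lerD2l.
elim: K => [|K [G HG mG]].
  exists (fun=> w0) => [w|]; last first.
    by rewrite big_ord0 mulr0 !addr0; exact: mean_le_cst.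
  by rewrite /W /lyapunov /= (admm_lam0 admm) !mul0r !mulr0 !add0r.
have HK := adapted_L2_all K; have [_ MK] := HM K.
exists (fun w => G w + - theta K * ip (err K w) (v K w - us)
    + 2 / rho * `|err K w| ^+ 2 + drift K * `|v K.+1 w - v K w| ^+ 2).
  move=> w; apply: le_trans (lyapunovS hip Uad_convex g_proper g_convex
    f_strongly_convex gradf_lipschitz optimal multiplier theta0 theta_gt0 thetaS
    mu01 rho0 eta0 rho_eta_le eta_mu admm K w) _.
  rewrite -/(err K w) -/(W K w) mulNr !lerD2r; exact: HG.
have E : w0 + \sum_(k < K.+1) x k + B * K.+1%:R =
    (w0 + \sum_(k < K) x k + B * K%:R) + 0 + B + x K.
  by rewrite big_ord_recr /= -natr1; ring.
rewrite E; apply: mean_leD; last exact: mean_leZ.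
apply: mean_leD; last by apply: mean_leZ => //; exact: gradient_error_variance.
by apply: mean_leD => //; exact: gradient_error_unbiased.
Qed.

(** The mean of [X k.+1] is at most [t/2] plus a linear function of [k] over [theta k ^+ 2], and the
    quotient tends to 0. *)
Lemma expectation_cvg0 (X : nat -> T -> R) : (forall k w, 0 <= X k w) ->
  (forall t : R, 0 < t -> exists c1 c2 : R, [/\ 0 <= c1, 0 <= c2 & forall k w,
     X k.+1 w <= t / 2 + (c1 + c2 * W k.+1 w) / theta k ^+ 2]) ->
  'E_P[X k]%E @[k --> \oo] --> 0%E.
Proof.
move=> X0 HX; have [A [B [A0 B0 HW]]] := lyapunov_mean_growth.
have key (t : R) : 0 < t -> \forall k \near \oo, ('E_P[X k] <= t%:E)%E.
  move=> t0; have [c1 [c2 [c10 c20 Hc]]] := HX t t0.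
  pose D := c1 + c2 * (A + B).
  have D0 : 0 <= D by rewrite addr_ge0 // mulr_ge0 // addr_ge0.
  (* For such [k], [D (k + 1) <= t k (k + 1) / 8 <= t/2 (1 + k/2)^2 <= t/2 theta_k^2]. *)
  have [N _ HN] := nbhs_infty_ger (8 * D / t).
  exists N.+1 => // -[//|k] /= Nk.
  have {}HN := HN k Nk; rewrite /= in HN.
  have [G WG mG] := HW k.+1.
  have q0 : 0 < theta k ^+ 2 by rewrite exprn_gt0.
  have qi0 : 0 <= (theta k ^+ 2)^-1 by rewrite invr_ge0 ltW.
  have mean := mean_leD (mean_le_cst P (t / 2))
    (mean_leZ qi0 (mean_leD (mean_le_cst P c1) (mean_leZ c20 mG))).
  have Xle w : X k.+1 w <= t / 2 + (theta k ^+ 2)^-1 * (c1 + c2 * G w).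
    apply: le_trans (Hc k w) _; rewrite lerD2l mulrC ler_wpM2l // lerD2l.
    by rewrite ler_wpM2l.
  apply: le_trans (ge0_expectation_le (X0 k.+1) Xle mean) _.
  rewrite lee_fin; have tk := theta_ge theta0 theta_gt0 thetaS k.
  rewrite [leRHS]splitr lerD2l mulrC ler_pdivrMr //.
  have k0 : 0 <= k%:R :> R by [].
  have Dk : c1 + c2 * (A + B * k.+1%:R) <= D * (k%:R + 1).
    rewrite /D -natr1.
    have : 0 <= c1 * k%:R by rewrite mulr_ge0.
    have : 0 <= c2 * A * k%:R by rewrite !mulr_ge0.
    lra.
  apply: le_trans Dk _.
  have tk2 : (1 + k%:R / 2) ^+ 2 <= theta k ^+ 2.
    by rewrite lerXn2r ?nnegrE // ?ltW // addr_ge0 // divr_ge0.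
  apply: (@le_trans _ _ (t / 2 * (1 + k%:R / 2) ^+ 2)); last first.
    by rewrite ler_pM2l // divr_gt0.
  have {}HN : 8 * D * (k%:R + 1) <= k%:R * t * (k%:R + 1).
    by rewrite ler_wpM2r ?addr_ge0 // -ler_pdivrMr.
  have : 0 <= t * k%:R by rewrite mulr_ge0 // ltW.
  have : 0 <= t * k%:R * k%:R by rewrite !mulr_ge0 // ltW.
  by move: HN; rewrite expr2; lra.
have E0 k : (0 <= 'E_P[X k])%E by apply: expectation_ge0 => w; exact: X0.
apply/fine_cvgP; split.
  have := key 1 ltr01; apply: filterS => k Ek.
  by rewrite ge0_fin_numE //; apply: le_lt_trans Ek _; rewrite ltry.
apply/cvgrPdist_le => e e0; have := key e e0; apply: filterS => k Ek.
have fk : 'E_P[X k]%E \is a fin_num.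
  by rewrite ge0_fin_numE //; apply: le_lt_trans Ek _; rewrite ltry.
by rewrite /= sub0r normrN ger0_norm ?fine_ge0 // -lee_fin fineK.
Qed.

End StochasticTrajectory.

Theorem theorem2p6 (R : realType) (U : completeNormedModType R)
    (ip : {dot U for idfun}) (hip : norm_of_dot ip)
    (Uad : set U) (Uad_nonempty : Uad !=set0) (Uad_closed : closed Uad)
    (Uad_convex : convex_set (Uad : set (convex_lmodType U)))
    (d : measure_display) (T : measurableType d) (P : probability T R)
    (n : nat) (Xi : set (n.-tuple R)) (xi : {RV P >-> n.-tuple R})
    (xi_in : forall w, Xi (xi w))
    (F : U -> n.-tuple R -> R) (gradF : U -> n.-tuple R -> U)
    (F_convex : forall x, Xi x ->
       convex_function (setT : set (convex_lmodType U)) (fun u => F u x))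
    (F_gradient : forall u x, Xi x ->
       is_gradient ip (fun y => F y x) u (gradF u x))
    (gradF_measurable : forall u, strongly_measurable_on Xi (gradF u))
    (f : U -> R) (gradf : U -> U)
    (F_integrable : forall u, P.-integrable setT (EFin \o (F u \o xi)))
    (f_def : forall u, 'E_P[F u \o xi]%E = (f u)%:E)
    (f_gradient : forall u, is_gradient ip f u (gradf u))
    (g : U -> \bar R) (g_proper : eproper g)
    (g_lsc : lower_semicontinuous g) (g_convex : econvex g)
    (alpha L : R) (alpha_gt0 : 0 < alpha)
    (f_strongly_convex : forall u v : U,
       f u + ip (gradf u) (v - u) + alpha / 2 * `|v - u| ^+ 2 <= f v)
    (gradf_lipschitz : forall u v : U,
       `|gradf u - gradf v| <= L * `|u - v|)
    (varrho : R)
    (gradF_unbiased : forall u,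
       bochner_expectation P (gradF u \o xi) (gradf u))
    (gradF_variance : forall u,
       ('E_P[fun w => (`|gradF u (xi w) - gradf u| ^+ 2)%R]
          <= (varrho ^+ 2)%:E)%E)
    (us zs lams : U) (us_zs_optimal : optimal_solution Uad f g us zs)
    (lams_multiplier : lagrange_multiplier ip Uad gradf g us zs lams)
    (m : nat -> nat) (m_gt1 : forall k, (1 < m k)%N)
    (xis : nat -> nat -> {RV P >-> n.-tuple R})
    (xis_iid : iid_samples Xi xi m xis)
    (theta : nat -> R) (theta0 : theta 0%N = 1)
    (theta_gt0 : forall k, 0 < theta k.+1)
    (thetaS : forall k, theta k.+1 ^+ 2 = theta k ^+ 2 + theta k.+1)
    (mu rho eta : R) (mu_in01 : 0 < mu < 1)
    (rho_gt0 : 0 < rho) (eta_gt0 : 0 < eta)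
    (rho_eta_le : rho + eta <= alpha)
    (eta_mu_gt : eta * (1 - mu) > rho * mu)
    (u0 z0 lam0 : U) (u z v s psi lam : nat -> T -> U)
    (admm : stochastic_admm ip Uad g gradF m
       (fun k i => xis k i : T -> n.-tuple R) mu
       (fun k => rho * theta k) (fun k => eta * theta k) theta
       u0 z0 lam0 u z v s psi lam) :
  'E_P[fun w => `|u k w - us|%R]%E @[k --> \oo] --> 0%E /\
  'E_P[fun w => `|z k w - zs|%R]%E @[k --> \oo] --> 0%E.
Proof.
have m0 k : (0 < m k)%N by apply: leq_trans (m_gt1 k).
have [xis_in xis_law xis_indep] := xis_iid.
(* Convexity enters for each sample value, to give the continuity that joint measurability
   requires. *)
have gradF_continuous x : Xi x -> continuous (gradF ^~ x).
  move=> Xx; have xg u' := F_gradient u' _ Xx.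
  exact: (gradient_continuous hip (convex_gradient_le (F_convex _ Xx) xg) xg).
have conv := expectation_cvg0 hip Uad_convex g_proper g_convex f_strongly_convex
  gradf_lipschitz us_zs_optimal lams_multiplier theta0 theta_gt0 thetaS mu_in01
  rho_gt0 eta_gt0 rho_eta_le eta_mu_gt gradF_measurable gradF_continuous xi_in
  gradF_unbiased gradF_variance m0 xis_in xis_law xis_indep admm.
have du := dist_u_le us lams theta0 theta_gt0 thetaS mu_in01 rho_gt0
  eta_gt0 rho_eta_le u v lam.
have dz := dist_z_le us lams theta0 theta_gt0 thetaS mu_in01 rho_gt0
  eta_gt0 rho_eta_le admm.
have [_ uszs] := optimal_solution_mem us_zs_optimal.
have mu0 : 0 < mu by case/andP: mu_in01.
split; apply: conv => // t t0.
  exists 0, (alpha * t)^-1; split=> // [|k w].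
    by rewrite invr_ge0 mulr_ge0 // ltW.
  by rewrite add0r; exact: du.
exists ((2 * (mu * rho))^-1 * (`|lam0 - lams| + 1)), ((alpha * t)^-1 + 2); split.
- by rewrite mulr_ge0 ?addr_ge0 // invr_ge0 ltW // !mulr_gt0.
- by rewrite addr_ge0 // invr_ge0 mulr_ge0 // ltW.
move=> k w; rewrite -uszs; apply: le_trans (dz k w) _.
have := du t k w alpha_gt0 t0.
rewrite !mulrDl; lra.
Qed.
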